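(* Let $Z(t)=\{\xi(t),x(t)\}$ be the two-dimensional Markov process described in the context, with cumulant $$\mathbf{\Psi}(\alpha)=\mathbf{\Lambda}\overline{\mathbf F}_0(0)\left(\mathbf C(\mathbf C-\imath\alpha\mathbf I)^{-1}-\mathbf I\right)+\int_{-\infty}^0(e^{\imath\alpha x}-1)\,d\mathbf K_0(x)+\mathbf Q ,$$ and let $s>0$, $T>0$, $0<x<T$. Then $$s\,\mathbf E\left[e^{-s\tau^+(x,T)},\ \xi(\tau^+(x,T))>z,\ A_+(x)\right]=\int_{x-T}^x d\mathbf H_s(T,x,y)\,\overline{\mathbf K}_0(z-y),\qquad z>x,$$ $$s\,\mathbf E\left[e^{-s\tau^-(x,T)},\ \xi(\tau^-(x,T))<z,\ A_-(x)\right]=\int_{x-T}^x d\mathbf H_s(T,x,y)\,\mathbf K_0(z-y),\qquad z<x-T,$$ where $\overline{\mathbf K}_0(u)=\int_u^\infty d\mathbf K_0(y)$ for $u>0$ and $\mathbf K_0(u)=\int_{-\infty}^u d\mathbf K_0(y)$ for $u<0$.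
   Context: Process. $x(t)$ is a finite irreducible nonperiodic continuous-time Markov chain with states $\{1,\dots,m\}$ and transition matrix $\mathbf P(t)=e^{t\mathbf Q}$, $\mathbf Q=\mathbf N(\mathbf P-\mathbf I)$, where $\mathbf N=\|\delta_{kr}\nu_k\|$, $\nu_k>0$ is the parameter of the exponential sojourn time $\zeta_k$ in state $k$, and $\mathbf P=\|p_{kr}\|$ is the transition matrix of the imbedded chain. $\xi(t)$, $\xi(0)=0$, is a process with stationary conditionally independent increments given $x(\cdot)$: while $x(t)=k$, $\xi$ is a pure jump process whose successive jumps are separated by exponential times of parameter $\lambda_k>0$ and have distribution function $F_k^0$; when $x$ passes from $k$ to $r$, $\xi$ makes a jump $\chi_{kr}$. Positive jumps of $\xi$ occur only between transitions of $x$ and in state $k$ they are exponential with parameter $c_k>0$ (so $1-F_k^0(x)=(1-F_k^0(0))e^{-c_kx}$ for $x>0$), and $\chi_{kr}\le 0$. Notation: $\mathbf\Lambda=\|\delta_{kr}\lambda_k\|$, $\mathbf C=\|\delta_{kr}c_k\|$, $\mathbf F_0(x)=\|\delta_{kr}F^0_k(x)\|$, $\overline{\mathbf F}_0(x)=\mathbf I-\mathbf F_0(x)$, $\mathbf F(x)=\|\mathrm P\{\chi_{kr}<x;\,x(\zeta_1)=r\mid x(0)=k\}\|$ (where $\zeta_1$ is the time of the first transition of $x(t)$), $d\mathbf K_0(x)=\mathbf N\,d\mathbf F(x)+\mathbf\Lambda\,d\mathbf F_0(x)$. Distribution functions are taken with strict inequality, so $\int_{-\infty}^u d\mathbf K_0$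 is the mass of $(-\infty,u)$. The cumulant is defined by $\|\mathrm E[e^{\imath\alpha\xi(t)},x(t)=r\mid x(0)=k]\|=e^{t\mathbf\Psi(\alpha)}$. Bold $\mathbf E[\,\cdot\,]$ and $\mathbf P\{\cdot\}$ evaluated at a random time denote $m\times m$ matrices whose $(k,r)$ entry is computed given $x(0)=k$ and on the event that the chain is in state $r$ at that time. $\theta_s$ is exponential with parameter $s>0$, independent of $Z$. Exit functionals. $\tau(x,T)=\inf\{t>0:\xi(t)\notin(x-T,x)\}$; $A_+(x)=\{\xi(\tau(x,T))\ge x\}$, $A_-(x)=\{\xi(\tau(x,T))\le x-T\}$; $\tau^{\pm}(x,T)$ denotes $\tau(x,T)$ on $A_\pm(x)$. $\mathbf H_s(T,x,y)=\mathbf P\{\xi(\theta_s)<y,\ \tau(x,T)>\theta_s\}$, so $d\mathbf H_s(T,x,\cdot)$ is a matrix measure on $(x-T,x)$ (including its atom at $0$). Matrix factors are multiplied in the order written. *)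

(* Defs.v *)
From HB Require Import structures.
From mathcomp Require Import all_boot all_order all_algebra.
From mathcomp Require Import all_classical all_reals all_analysis.
From mathcomp Require Import complex.

Set Implicit Arguments.
Unset Strict Implicit.
Unset Printing Implicit Defensive.

Import Order.TTheory GRing.Theory Num.Theory.
Import numFieldNormedType.Exports.

Local Open Scope classical_set_scope.
Local Open Scope ring_scope.

(* The data nu_k, lambda_k, c_k, P = (p_kr), together with the jump laws, given
   as probability measures: [jump_law k] is the law whose distribution function
   is F_k^0 and [trans_law k r] is the law of chi_kr.  Diagonal entries p_kk
   are not required to vanish. *)
Record map_param (R : realType) (m : nat) := MapParam {
  nu : 'I_m -> R;
  lam : 'I_m -> R;
  cpos : 'I_m -> R;
  ptrans : 'M[R]_m;
  jump_law : 'I_m -> probability (measurableTypeR R) R;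
  trans_law : 'I_m -> 'I_m -> probability (measurableTypeR R) R;
  nu_gt0 : forall k, 0 < nu k;
  lam_gt0 : forall k, 0 < lam k;
  cpos_gt0 : forall k, 0 < cpos k;
  ptrans_ge0 : forall k r, 0 <= ptrans k r;
  ptrans_sum1 : forall k, \sum_r ptrans k r = 1;
  (* 1 - F_k^0(x) = (1 - F_k^0(0)) e^{- c_k x}, F_k^0(x) being the mass of
     the open half-line ]-oo, x[ *)
  jump_law_pos : forall k (x : R), 0 < x ->
    1 - fine (jump_law k `]-oo, x[%classic) =
    (1 - fine (jump_law k `]-oo, 0[%classic)) * expR (- cpos k * x);
  trans_law_le0 : forall k r, trans_law k r `]0, +oo[%classic = 0%E
}.

(* A matrix measure is a set function with values in 'M[R]_m. *)
Definition mxmeas (R : realType) (m : nat) : Type := set R -> 'M[R]_m.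

(* [integral] only uses the set function underlying a measure, so that it
   applies directly to the entries of a matrix measure. *)
Definition entry_int (R : realType) (m : nat) (M : mxmeas R m) (k r : 'I_m)
    (D : set R) (f : R -> R) : R :=
  fine (\int[fun B : set (measurableTypeR R) => (M B k r)%:E]_(y in D)
          (f y)%:E)%E.

(* \int_D dM(y) G(y), with the measure as left factor *)
Definition mxint (R : realType) (m : nat) (M : mxmeas R m) (D : set R)
    (G : R -> 'M[R]_m) : 'M[R]_m :=
  \matrix_(k, r) \sum_j entry_int M k j D (fun y => G y j r).

Section parameters.
Variables (R : realType) (m : nat) (par : map_param R m).

Definition mxN : 'M[R]_m := diag_mx (\row_k nu par k).
Definition mxLambda : 'M[R]_m := diag_mx (\row_k lam par k).
Definition mxC : 'M[R]_m := diag_mx (\row_k cpos par k).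
Definition mxQ : 'M[R]_m := mxN *m (ptrans par - 1%:M).

(* dF_0, and dF with F_kr(B) = P{chi_kr \in B, x(zeta_1) = r | x(0) = k} *)
Definition mxF0 : mxmeas R m :=
  fun B => diag_mx (\row_k fine (jump_law par k B)).
Definition mxF : mxmeas R m :=
  fun B => \matrix_(k, r) (ptrans par k r * fine (trans_law par k r B)).

Definition dK0 : mxmeas R m := fun B => mxN *m mxF B + mxLambda *m mxF0 B.
Definition K0 (u : R) : 'M[R]_m := dK0 `]-oo, u[%classic.
(* distribution functions being left-continuous, \int_u^oo is the mass of the
   complement of ]-oo, u[ *)
Definition K0bar (u : R) : 'M[R]_m := dK0 `[u, +oo[%classic.

Local Open Scope complex_scope.

Definition cmx (A : 'M[R]_m) : 'M[R[i]]_m := map_mx (fun a => a%:C) A.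

Definition Psi (alpha : R) : 'M[R[i]]_m :=
  cmx (mxLambda *m (1%:M - mxF0 `]-oo, 0[%classic)) *m
    (cmx mxC *m invmx (cmx mxC - (0 +i* alpha)%:M) - 1%:M)
  + \matrix_(k, r)
      (entry_int dK0 k r `]-oo, 0[%classic (fun y => cos (alpha * y) - 1)
       +i* entry_int dK0 k r `]-oo, 0[%classic (fun y => sin (alpha * y)))
  + cmx mxQ.

(* B = e^A: the exponential series converges entrywise to B *)
Definition is_expmx (A B : 'M[R[i]]_m) : Prop :=
  forall k r : 'I_m,
    ((fun n => complex.Re ((\sum_(i < n) (i`!%:R)^-1 *: A ^+ i) k r))
       @ \oo --> complex.Re (B k r)) /\
    ((fun n => complex.Im ((\sum_(i < n) (i`!%:R)^-1 *: A ^+ i) k r))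
       @ \oo --> complex.Im (B k r)).

End parameters.

(* The process Z(t) = (xi(t), x(t)), t >= 0, under the laws P k of initial state
   x(0) = k.  The n-th stay of the chain takes place in state [emb n] and lasts
   [zeta n]; it ends with the jump [chi n] of xi.  During this stay the
   successive jumps of xi are the [kappa n l], separated by the times
   [eta n l]; the clock restarts at each transition, as is immaterial for
   exponential times. *)
Record map_process (R : realType) (m : nat) (par : map_param R m)
    (d : measure_display) (Omega : measurableType d)
    (P : 'I_m -> probability Omega R) := MapProcess {
  xi : R -> Omega -> R;
  st : R -> Omega -> 'I_m;
  emb : nat -> Omega -> 'I_m;
  zeta : nat -> Omega -> R;
  chi : nat -> Omega -> R;
  eta : nat -> nat -> Omega -> R;
  kappa : nat -> nat -> Omega -> R;

  measurable_xi : forall t, 0 <= t -> measurable_fun setT (xi t);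
  measurable_st : forall t j, 0 <= t -> measurable [set w | st t w = j];
  measurable_emb : forall n j, measurable [set w | emb n w = j];
  measurable_zeta : forall n, measurable_fun setT (zeta n);
  measurable_chi : forall n, measurable_fun setT (chi n);
  measurable_eta : forall n l, measurable_fun setT (eta n l);
  measurable_kappa : forall n l, measurable_fun setT (kappa n l);

  (* the joint law of all these variables: (emb n) is a Markov chain with
     transition matrix (p_kr) started at k, and given it the other variables
     are independent with the prescribed laws *)
  driving_law : forall (k : 'I_m) (N L : nat) (j : nat -> 'I_m)
      (Bz Bc : nat -> set (measurableTypeR R))
      (Be Bk : nat -> nat -> set (measurableTypeR R)),
    (forall n, measurable (Bz n)) -> (forall n, measurable (Bc n)) ->
    (forall n l, measurable (Be n l)) -> (forall n l, measurable (Bk n l)) ->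
    P k [set w | emb 0 w = j 0%N /\
      forall n, (n < N)%N ->
        [/\ emb n.+1 w = j n.+1, Bz n (zeta n w), Bc n (chi n w) &
            forall l, (l < L)%N ->
              Be n l (eta n l w) /\ Bk n l (kappa n l w)]] =
    ((j 0%N == k)%:R%:E *
     \prod_(n < N)
       (exponential_prob (nu par (j n)) (Bz n) *
        ((ptrans par (j n) (j n.+1))%:E *
         trans_law par (j n) (j n.+1) (Bc n)) *
        \prod_(l < L)
          (exponential_prob (lam par (j n)) (Be n l) *
           jump_law par (j n) (Bk n l))))%E;

  (* the paths are step functions on [0, +oo[ *)
  zeta_gt0 : forall n w, 0 < zeta n w;
  eta_gt0 : forall n l w, 0 < eta n l w;
  zeta_unbounded : forall w t, exists n, t < \sum_(i < n) zeta i w;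
  eta_unbounded : forall n w t, exists l, t < \sum_(i < l) eta n i w;

  xi0 : forall w, xi 0 w = 0;
  st_path : forall n w t,
    \sum_(i < n) zeta i w <= t < \sum_(i < n.+1) zeta i w ->
    st t w = emb n w;
  xi_stay : forall n l w u, u < zeta n w ->
    \sum_(i < l) eta n i w <= u < \sum_(i < l.+1) eta n i w ->
    xi (\sum_(i < n) zeta i w + u) w =
    xi (\sum_(i < n) zeta i w) w + \sum_(i < l) kappa n i w;
  xi_transition : forall n l w,
    \sum_(i < l) eta n i w < zeta n w <= \sum_(i < l.+1) eta n i w ->
    xi (\sum_(i < n.+1) zeta i w) w =
    xi (\sum_(i < n) zeta i w) w + \sum_(i < l) kappa n i w + chi n w
}.

Section process.
Variables (R : realType) (m : nat) (par : map_param R m).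
Variables (d : measure_display) (Omega : measurableType d).
Variables (P : 'I_m -> probability Omega R) (Z : map_process par P).

(* E[f, D] and P{D} at the random time rho: the (k, r) entry is computed under
   x(0) = k on the event {rho < +oo, x(rho) = r} *)
Definition at_state (rho : Omega -> \bar R) (r : 'I_m) : set Omega :=
  [set w | (rho w < +oo)%E /\ st Z (fine (rho w)) w = r].
Definition Emx (rho : Omega -> \bar R) (f : Omega -> R) (D : set Omega) :
    'M[R]_m :=
  \matrix_(k, r) (\int[P k]_(w in D `&` at_state rho r) f w)%R.
Definition Pmx (rho : Omega -> \bar R) (D : set Omega) : 'M[R]_m :=
  \matrix_(k, r) fine (P k (D `&` at_state rho r)).

Definition trans_mx (t : R) : 'M[R]_m := Pmx (fun=> t%:E) setT.

Definition irreducible_chain : Prop :=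
  forall k r, exists2 t, 0 < t & 0 < trans_mx t k r.
Definition nonperiodic_chain : Prop :=
  forall k, ~ exists2 h, 0 < h &
    forall t, 0 < t -> 0 < trans_mx t k k -> exists n : nat, t = n%:R * h.

Definition charmx (t alpha : R) : 'M[R[i]]_m :=
  \matrix_(k, r)
    (Emx (fun=> t%:E) (fun w => cos (alpha * xi Z t w)) setT k r
     +i* Emx (fun=> t%:E) (fun w => sin (alpha * xi Z t w)) setT k r)%C.

Definition is_cumulant (Ps : R -> 'M[R[i]]_m) : Prop :=
  forall t alpha, 0 <= t -> is_expmx (t%:C%C *: Ps alpha) (charmx t alpha).

Definition sigmaZ : set (set Omega) :=
  <<s [set A | exists2 t, 0 <= t &
         (exists2 B : set (measurableTypeR R), measurable B &
            A = xi Z t @^-1` B) \/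
         (exists j, A = [set w | st Z t w = j])] >>.

Record exp_time (s : R) (theta : Omega -> R) : Prop := ExpTime {
  exp_time_ge0 : forall w, 0 <= theta w;
  exp_time_measurable : measurable_fun setT theta;
  exp_time_law : forall k (B : set (measurableTypeR R)), measurable B ->
    P k (theta @^-1` B) = exponential_prob s B;
  exp_time_indep : forall k A (B : set (measurableTypeR R)),
    sigmaZ A -> measurable B ->
    P k (A `&` theta @^-1` B) = (P k A * P k (theta @^-1` B))%E
}.

Definition tau (x T : R) (w : Omega) : \bar R :=
  ereal_inf
    [set t%:E | t in [set t : R | 0 < t /\ ~ `]x - T, x[%classic (xi Z t w)]].

Definition xi_tau (x T : R) (w : Omega) : R := xi Z (fine (tau x T w)) w.

Definition A_plus (x T : R) : set Omega :=
  [set w | (tau x T w < +oo)%E /\ x <= xi_tau x T w].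
Definition A_minus (x T : R) : set Omega :=
  [set w | (tau x T w < +oo)%E /\ xi_tau x T w <= x - T].

(* the matrix measure with distribution function
   H_s(T, x, y) = P{xi(theta) < y, tau(x, T) > theta} *)
Definition dH (theta : Omega -> R) (T x : R) : mxmeas R m :=
  fun B => Pmx (fun w => (theta w)%:E)
    [set w | B (xi Z (theta w) w) /\ ((theta w)%:E < tau x T w)%E].

End process.

(* Main.v *)
(* xi and x are constant on epochs.  After the start of an epoch at level y in
   state j, the sojourn clock (rate nu_j) and the jump clock (rate lambda_j)
   compete; they are memoryless and independent of the past, of the next state
   and of the jump sizes.  So, up to the common factor
   E[e^{-s (start of the epoch)}] / (nu_j + lambda_j + s), the discounted
   probability that the epoch ends with a jump into the exit set J is
   dK_0(J - y)_{jr}, and the probability that theta_s falls into the epoch is s.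
   Since theta_s is independent of the paths, summing over the epochs that
   start before the exit turns the latter into dH_s and the former into the
   exit functional. *)

Require Import Defs.
From HB Require Import structures.
From mathcomp Require Import all_boot all_order all_algebra.
From mathcomp Require Import all_classical all_reals all_analysis.
From mathcomp Require Import complex.
From mathcomp Require Import measurable_realfun ring lra.

Set Implicit Arguments.
Unset Strict Implicit.
Unset Printing Implicit Defensive.

Import Order.TTheory GRing.Theory Num.Theory.
Import numFieldNormedType.Exports.

Local Open Scope classical_set_scope.
Local Open Scope ring_scope.

(** Whether the epoch (n, l) is reached depends on [zeta n], which is also one of the two clocks
    racing in that epoch. The past is therefore the sigma-algebra of the variables preceding the
    epoch, [zeta n] excluded, and the whole sojourn time is integrated against the elapsed jump
    clock. Memorylessness then shows up as a factor e^{- nu_j clock} instead of a conditioning.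
    Independence of past and future is given on product boxes only, and is extended by uniqueness of
    measures on an intersection-stable family.

    The variable [theta] is assumed independent of the process, not of its driving variables. Fubini
    is thus applied over the sigma-algebra generated by xi and x, and the decomposition into epochs
    is made afterwards, for each path separately.

    All identities are first proved between nonnegative extended-real integrals. The passage to real
    matrices needs finiteness, which comes from the bound nu_j + lambda_j on the kernel. *)

(** * Restricted measures and densities *)

Section integral_extra.
Local Open Scope ereal_scope.
Context d (T : measurableType d) (R : realType).

Import HBNNSimple.

(** The complement of [D] is null for the restricted measure. Integrals over an event thus become
    integrals over the whole space, the form that image measures require. *)
Lemma ge0_integral_mrestr (mu : {measure set T -> \bar R}) (D : set T)
    (mD : measurable D) (f : T -> \bar R) :
  measurable_fun setT f -> (forall x, 0 <= f x) ->
  \int[mrestr mu mD]_x f x = \int[mu]_(x in D) f x.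
Proof.
move=> mf f0; have mC : measurable (~` D) by exact: measurableC.
rewrite -(setUv D) ge0_integral_setU//; last 2 first.
- by rewrite setUv.
- exact/disj_setPCl.
rewrite [X in _ + X]null_set_integral ?adde0//; last 2 first.
- exact: measurable_funTS.
- by rewrite /= /mrestr setICl measure0.
apply: (eq_measure_integral mu) => A mA AD.
by rewrite /= /mrestr setIidl.
Qed.

(** The density is known through the masses of sets only. The formula passes from indicators to
    simple functions by linearity and to [f] by monotone convergence. *)
Lemma ge0_integral_density (mu nu : {measure set T -> \bar R})
    (p : T -> R) (f : T -> \bar R) :
  measurable_fun setT p -> (forall x, 0 <= p x)%R ->
  (forall A, measurable A -> nu A = \int[mu]_(x in A) (p x)%:E) ->
  measurable_fun setT f -> (forall x, 0 <= f x) ->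
  \int[nu]_x f x = \int[mu]_x (f x * (p x)%:E).
Proof.
move=> mp p0 nuE mf f0.
have mpE : measurable_fun setT (EFin \o p) by exact/measurable_EFinP.
have step (A : set T) (r : R) : measurable A -> (0 <= r)%R ->
    \int[nu]_x (r * \1_A x)%:E = \int[mu]_x ((r * \1_A x)%:E * (p x)%:E).
  move=> mA r0; have mA1 : measurable_fun setT (fun x => (\1_A x)%:E : \bar R).
    exact/measurable_EFinP.
  under eq_integral do rewrite EFinM.
  rewrite ge0_integralZl_EFin//.
  rewrite integral_indic// setIT nuE// integral_mkcond.
  rewrite -ge0_integralZl_EFin//; last 2 first.
  - by move=> x _; apply: erestrict_ge0 => y _; rewrite lee_fin.
  - apply/(measurable_restrictT _ _).1 => //; exact/measurable_funTS.
  apply: eq_integral => x _.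
  by rewrite EFinM -muleA epatch_indic (muleC (p x)%:E).
have sfun (h : {nnsfun T >-> R}) :
    \int[nu]_x (h x)%:E = \int[mu]_x ((h x)%:E * (p x)%:E).
  under eq_integral do rewrite fimfunE -fsumEFin//.
  rewrite ge0_integral_fsum//; last 2 first.
  - by move=> r; exact/measurable_EFinP/measurableT_comp.
  - by move=> r x _; rewrite EFinM nnfun_muleindic_ge0.
  under [RHS]eq_integral.
    move=> x _; rewrite fimfunE -fsumEFin// ge0_mule_fsuml; last first.
      by move=> r; rewrite EFinM nnfun_muleindic_ge0.
    over.
  rewrite ge0_integral_fsum//; last 2 first.
  - move=> r; apply: emeasurable_funM => //.
    exact/measurable_EFinP/measurableT_comp.
  - by move=> r x _; rewrite mule_ge0 ?lee_fin// -lee_fin EFinM nnfun_muleindic_ge0.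
  by apply: eq_fsbigr => r; rewrite inE => -[x _ <-]; exact: step.
pose g := nnsfun_approx measurableT mf.
transitivity (limn (fun n => \int[nu]_x (g n x)%:E)).
  rewrite -monotone_convergence//=.
  - apply: eq_integral => x _; apply/esym/cvg_lim => //.
    exact: cvg_nnsfun_approx.
  - by move=> n; exact/measurable_EFinP.
  - by move=> n x _; rewrite lee_fin.
  - by move=> x _ m n mn; rewrite lee_fin; exact/lefP/nd_nnsfun_approx.
under eq_fun do rewrite sfun.
rewrite -monotone_convergence//=.
- apply: eq_integral => x _; apply/cvg_lim => //.
  by apply: cvgeZr => //; apply: cvg_nnsfun_approx.
- by move=> n; apply: emeasurable_funM => //; exact/measurable_EFinP.
- by move=> n x _; rewrite mule_ge0// lee_fin.
- move=> x _ m n mn; rewrite lee_wpmul2r ?lee_fin//.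
  exact/lefP/nd_nnsfun_approx.
Qed.

End integral_extra.

(** * Finite image measures *)

Section image_measure.
Context {d d1 : measure_display} {T : measurableType d}
  {T1 : measurableType d1} {R : realType}.

(** A copy of [pushforward] that carries the measurability of [V], so that finiteness can be
    attached to it canonically and products can be formed. *)
Definition image_measure (mu : {finite_measure set T -> \bar R}) (V : T -> T1)
  (mV : measurable_fun setT V) : set T1 -> \bar R := pushforward mu V.

Variables (mu : {finite_measure set T -> \bar R}) (V : T -> T1)
  (mV : measurable_fun setT V).

HB.instance Definition _ := Measure.copy (image_measure mu mV)
  (measure_function_pushforward__canonical__measure_function_Measure mu mV).

Let image_measure_fin : fin_num_fun (image_measure mu mV).
Proof.
move=> A mA; rewrite /image_measure /pushforward fin_num_measure//.
by rewrite -[X in measurable X]setTI; exact: mV.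
Qed.

HB.instance Definition _ := Measure_isFinite.Build _ _ _ (image_measure mu mV)
  image_measure_fin.

End image_measure.

(** * From independence on rectangles to integrals *)

Section independence.
Local Open Scope ereal_scope.
Context {d d1 d2 : measure_display} {T : measurableType d}
  {T1 : measurableType d1} {T2 : measurableType d2} {R : realType}.

(** Under [nu] the law of (V, X) is c times the product of the law of V under [mu] with [rho], by
    uniqueness of product measures; Tonelli does the rest. Two measures are needed because [nu] may
    live on a smaller event, whose conditional probability is the factor [c]. *)
Lemma integral_indep (mu nu : {finite_measure set T -> \bar R}) (c : {nonneg R})
    (rho : probability T2 R) (V : T -> T1) (X : T -> T2) (f : T1 * T2 -> \bar R) :
  measurable_fun setT V -> measurable_fun setT X ->
  (forall A B, measurable A -> measurable B ->
    nu (V @^-1` A `&` X @^-1` B) = c%:num%:E * mu (V @^-1` A) * rho B) ->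
  measurable_fun setT f -> (forall x, 0 <= f x) ->
  \int[nu]_w f (V w, X w) = c%:num%:E * \int[mu]_w \int[rho]_x f (V w, x).
Proof.
move=> mV mX indep mf f0.
have mVX : measurable_fun setT (fun w => (V w, X w)) by exact/measurable_fun_pair.
transitivity (\int[image_measure nu mVX]_z f z).
  by rewrite (ge0_integral_pushforward mVX).
rewrite (eq_measure_integral (mscale c (image_measure mu mV) \x rho)); last first.
  move=> A mA _; apply/esym; apply: product_measure_unique => //.
rewrite fubini_tonelli1// ge0_integral_mscale//; last 2 first.
- exact: measurable_fun_fubini_tonelli_F.
- by move=> x _; apply: integral_ge0.
congr (_ * _); rewrite (ge0_integral_pushforward mV)//.
  exact: measurable_fun_fubini_tonelli_F.
by move=> x _; apply: integral_ge0.
Qed.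

(** The constant is absorbed into the first factor, which turns the hypothesis into a product
    measure on rectangles. This allows variables to be split off one at a time. *)
Lemma pair_indep (mu : {finite_measure set T -> \bar R}) (c : \bar R)
    (rho1 : probability T1 R) (rho2 : probability T2 R) (X1 : T -> T1) (X2 : T -> T2) :
  measurable_fun setT X1 -> measurable_fun setT X2 ->
  (forall A B, measurable A -> measurable B ->
    mu (X1 @^-1` A `&` X2 @^-1` B) = c * rho1 A * rho2 B) ->
  forall C, measurable C ->
    mu [set w | C (X1 w, X2 w)] = c * (rho1 \x rho2) C.
Proof.
move=> mX1 mX2 indep C mC.
have c0 : 0 <= c.
  have := indep setT setT measurableT measurableT.
  by rewrite !probability_setT !mule1 => <-.
have cfin : c \is a fin_num.
  have := indep setT setT measurableT measurableT.
  rewrite !probability_setT !mule1 => <-.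
  by rewrite !preimage_setT setIT fin_num_measure.
have mX : measurable_fun setT (fun w => (X1 w, X2 w)) by exact/measurable_fun_pair.
rewrite -[in RHS](fineK cfin).
have fc0 : (0 <= fine c)%R by exact: fine_ge0.
pose rho1' : {sigma_finite_measure set T1 -> \bar R} := mscale (NngNum fc0) rho1.
have -> : (fine c)%:E * (rho1 \x rho2) C = (rho1' \x rho2) C.
  rewrite /product_measure1 ge0_integral_mscale//.
  exact: measurable_fun_xsection.
apply/esym; rewrite -[RHS]/(image_measure mu mX C); apply: product_measure_unique => // A B mA mB.
by rewrite /= /mscale /= fineK// -indep.
Qed.

End independence.

(** * The exponential law *)

Section exponential.
Context {R : realType}.
Implicit Types a b u : R.

Definition expo a (a0 : 0 < a) : probability (measurableTypeR R) R :=
  exponential_distribution_exponential_prob__canonical__probability_measure_Probability a0.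

Lemma expoE a (a0 : 0 < a) B : expo a0 B = exponential_prob a B.
Proof. by []. Qed.

Lemma integral_expo a (a0 : 0 < a) (f : R -> \bar R) :
  measurable_fun setT f -> (forall x, 0 <= f x)%E ->
  (\int[expo a0]_x f x =
   \int[lebesgue_measure]_x (f x * (exponential_pdf a x)%:E))%E.
Proof.
move=> mf f0; apply: (@ge0_integral_density _ (measurableTypeR R)) => //.
  exact: measurable_exponential_pdf.
by move=> x; apply: exponential_pdf_ge0; exact: ltW.
Qed.

Lemma expo_lt0 a (a0 : 0 < a) : expo a0 `]-oo, 0%R[%classic = 0%E.
Proof.
rewrite expoE /exponential_prob integral0_eq// => x.
by rewrite /= in_itv/= => x0; rewrite lt0_exponential_pdf.
Qed.

Lemma expo_set1 a (a0 : 0 < a) u : expo a0 [set u] = 0%E.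
Proof. by rewrite expoE /exponential_prob integral_set1. Qed.

Lemma expo_gt a (a0 : 0 < a) u : 0 <= u ->
  expo a0 `]u, +oo[%classic = (expR (- (a * u)))%:E.
Proof.
move=> u0.
have Egt : expo a0 `]u, +oo[%classic =
    (1 - (expo a0 `]-oo, 0%R[%classic + expo a0 `[0%R, u]%classic))%E.
  rewrite -measureU//=; last first.
    rewrite -subset0 => t [/=]; rewrite !in_itv/= => t0.
    by rewrite leNgt t0.
  rewrite -probability_setC; last by apply: measurableU.
  congr (expo a0 _); apply/seteqP; split=> t /=; rewrite !in_itv/= !andbT.
    by move=> ut [|/andP[_]]; [rewrite ltNge (le_trans u0)// ltW | rewrite leNgt ut].
  move=> /not_orP[/negP]; rewrite -leNgt => t0 /negP.
  by rewrite t0/= -ltNge.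
rewrite Egt expo_lt0 add0e expoE.
(* The closed formula for the mass of [0, u] requires u > 0, so u = 0 is treated apart. *)
have [->|u1] := eqVneq u 0.
  rewrite set_itv1 /exponential_prob integral_set1 sube0.
  by rewrite mulr0 oppr0 expR0.
rewrite exponential_prob_itv0c ?lt_def ?u1//.
by rewrite -!EFinB opprB addrCA subrr addr0 mulNr.
Qed.

Lemma expo_ge a (a0 : 0 < a) u : 0 <= u ->
  expo a0 `[u, +oo[%classic = (expR (- (a * u)))%:E.
Proof.
move=> u0.
have -> : `[u, +oo[%classic = [set u] `|` `]u, +oo[%classic :> set (measurableTypeR R).
  by rewrite setU1itv.
rewrite measureU//; last first.
  by rewrite -subset0 => t [/= ->]; rewrite in_itv/= ltxx.
transitivity (0 + (expR (- (a * u)))%:E)%E; last by rewrite add0e.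
by apply: f_equal2; [exact (expo_set1 a0 u)|exact: expo_gt].
Qed.

(** Discounting at rate b turns the density of rate a into a / (a + b) times the density of rate a +
    b. *)
Lemma integral_expR_expo a (a0 : 0 < a) b u : 0 <= b -> 0 <= u ->
  (\int[expo a0]_(t in `[u, +oo[) (expR (- (b * t)))%:E =
   (a / (a + b) * expR (- ((a + b) * u)))%:E)%E.
Proof.
move=> b0 u0; have ab0 : 0 < a + b by exact: ltr_wpDr.
have mexp : measurable_fun setT (fun t => (expR (- (b * t)))%:E : \bar R).
  apply/measurable_EFinP; apply: (measurableT_comp (@measurable_expR R)).
  by apply: (measurableT_comp (@oppr_measurable R setT)); apply: measurable_funM.
rewrite integral_mkcond integral_expo; last 2 first.
- by apply/(measurable_restrictT _ _).1 => //; exact: measurable_funTS.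
- by move=> x; apply: erestrict_ge0 => t _; rewrite lee_fin expR_ge0.
transitivity ((a / (a + b))%:E * exponential_prob (a + b) `[u, +oo[)%E; last first.
  by have := expo_ge ab0 u0; rewrite expoE => ->; rewrite -EFinM.
rewrite /exponential_prob [in RHS]integral_mkcond.
have c0 : 0 <= a / (a + b) by rewrite divr_ge0// ltW.
have mpdf : measurable_fun setT
    ((fun x => (exponential_pdf (a + b) x)%:E) \_ `[u, +oo[ : R -> \bar R).
  apply/(measurable_restrictT _ _).1 => //; apply/measurable_funTS/measurable_EFinP.
  exact: measurable_exponential_pdf.
transitivity (\int[lebesgue_measure]_x ((a / (a + b))%:E *
    ((fun x => (exponential_pdf (a + b) x)%:E) \_ `[u, +oo[ : R -> \bar R) x))%E; last first.
  rewrite ge0_integralZl_EFin// => t _; apply: erestrict_ge0 => x _.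
  by rewrite lee_fin exponential_pdf_ge0// ltW.
apply: eq_integral => t _; rewrite /patch; case: ifPn; last by rewrite mule0 mul0e.
rewrite inE/= in_itv/= andbT => ut; have t0 : 0 <= t by exact: le_trans ut.
rewrite !exponential_pdfE// -!EFinM; congr EFin.
rewrite (_ : - (a + b) * t = - (b * t) + - a * t); last by ring.
rewrite expRD.
by field; rewrite gt_eqF.
Qed.

End exponential.

(** * Partial sums of positive sequences *)

Definition psum {R : realType} (f : nat -> R) (n : nat) : R :=
  \sum_(i < n) f i.

Section partial_sums.
Context {R : realType} (f : nat -> R).
Hypothesis f_gt0 : forall i, 0 < f i.

Local Notation F := (psum f).

Lemma partial_sum_lt n p : (n < p)%N -> F n < F p.
Proof.
elim: p => // p IH; rewrite ltnS leq_eqVlt => /orP[/eqP->|np].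
  by rewrite /psum big_ord_recr/= ltrDl.
by apply: lt_trans (IH np) _; rewrite /psum big_ord_recr/= ltrDl.
Qed.

Lemma partial_sum_le n p : (n <= p)%N -> F n <= F p.
Proof.
by rewrite leq_eqVlt => /orP[/eqP->//|/partial_sum_lt/ltW].
Qed.

Lemma partial_sum_ltP n p : F n < F p -> (n < p)%N.
Proof. by apply: contraTT; rewrite -leqNgt -leNgt; exact: partial_sum_le. Qed.

Lemma partial_sum_ge0 n : 0 <= F n.
Proof. by have := partial_sum_le (leq0n n); rewrite /psum big_ord0. Qed.

Hypothesis F_unbounded : forall t, exists n, t < F n.

Lemma partial_sum_locate t : 0 <= t -> exists n, F n <= t < F n.+1.
Proof.
move=> t0; have /ex_minnP[[|n] tn nmin] := F_unbounded t.
  by move: tn; rewrite ltNge /psum big_ord0 t0.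
exists n; rewrite tn andbT leNgt; apply/negP => /nmin.
by rewrite ltnn.
Qed.

(** The interval is closed on the right, unlike the one above: this version finds the last jump
    strictly before a transition, a tie being decided in favour of the transition. *)
Lemma partial_sum_locate_right t : 0 < t -> exists n, F n < t <= F n.+1.
Proof.
move=> t0; have ex : exists n, t <= F n.
  by have [n /ltW] := F_unbounded t; exists n.
have /ex_minnP[[|n] tn nmin] := ex.
  by move: tn; rewrite leNgt /psum big_ord0 t0.
exists n; rewrite tn andbT ltNge; apply/negP => /nmin.
by rewrite ltnn.
Qed.

End partial_sums.

(** * Decomposition of the paths into epochs *)

Section paths.
Context {R : realType} {m : nat} {par : map_param R m}
  {d : measure_display} {Omega : measurableType d}
  {P : 'I_m -> probability Omega R} (Z : map_process par P).
Implicit Types (n l : nat) (t : R) (w : Omega).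

Definition stay_start n w : R := psum (zeta Z ^~ w) n.
Definition jump_clock n l w : R := psum (fun i => Defs.eta Z n i w) l.
(** Defined for every l, so that it depends only on variables preceding the epoch (n, l). It is a
    value of xi when that epoch exists. *)
Definition level n l w : R :=
  xi Z (stay_start n w) w + \sum_(i < l) kappa Z n i w.
(** The inequality is strict because, when the jump clock reaches [zeta n] exactly, the transition
    takes place and the jump does not. *)
Definition alive n l w : bool := jump_clock n l w < zeta Z n w.

(* The epoch (n, l) is the l-th interval of constancy of xi inside the n-th
   stay of the chain; it exists if [alive n l]. *)
Definition epoch_start n l w : R := stay_start n w + jump_clock n l w.
Definition epoch_end n l w : R :=
  Num.min (stay_start n.+1 w) (epoch_start n l.+1 w).
Definition epoch n l w t : bool := epoch_start n l w <= t < epoch_end n l w.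

Local Notation S := stay_start.
Local Notation E := jump_clock.

Let zeta0 w n : 0 < zeta Z n w. Proof. exact: zeta_gt0. Qed.
Let eta0 n w l : 0 < Defs.eta Z n l w. Proof. exact: eta_gt0. Qed.
Let S_unbounded w t : exists n, t < S n w. Proof. exact: zeta_unbounded. Qed.
Let E_unbounded n w t : exists l, t < E n l w. Proof. exact: eta_unbounded. Qed.

Lemma stay_startS n w : S n.+1 w = S n w + zeta Z n w.
Proof. by rewrite /S /psum big_ord_recr. Qed.

Lemma stay_start0 w : S 0 w = 0. Proof. by rewrite /S /psum big_ord0. Qed.

Lemma jump_clock0 n w : E n 0 w = 0. Proof. by rewrite /E /psum big_ord0. Qed.

Lemma jump_clockS n l w : E n l.+1 w = E n l w + Defs.eta Z n l w.
Proof. by rewrite /E /psum big_ord_recr. Qed.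

Lemma stay_start_ge0 n w : 0 <= S n w.
Proof. exact: (partial_sum_ge0 (zeta0 w)). Qed.

Lemma jump_clock_ge0 n l w : 0 <= E n l w.
Proof. exact: (partial_sum_ge0 (eta0 n w)). Qed.

Lemma level00 w : level 0 0 w = 0.
Proof. by rewrite /level stay_start0 xi0 big_ord0 addr0. Qed.

Lemma alive0 n w : alive n 0 w.
Proof. by rewrite /alive jump_clock0. Qed.

Lemma aliveW n l l' w : (l' <= l)%N -> alive n l w -> alive n l' w.
Proof. by move=> ll; apply: le_lt_trans; exact: (partial_sum_le (eta0 n w)). Qed.

Lemma epoch_start_ge0 n l w : 0 <= epoch_start n l w.
Proof. by rewrite addr_ge0 ?stay_start_ge0 ?jump_clock_ge0. Qed.

Lemma epochE n l w t : epoch n l w t =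
  [&& epoch_start n l w <= t, t < S n.+1 w & t < epoch_start n l.+1 w].
Proof. by rewrite /epoch /epoch_end lt_min. Qed.

Lemma epoch_alive n l w t : epoch n l w t -> alive n l w.
Proof.
rewrite epochE => /and3P[h1 h2 _]; rewrite /alive -(ltrD2l (S n w)) -stay_startS.
exact: le_lt_trans h2.
Qed.

Lemma epoch_startP n l w : alive n l w -> epoch n l w (epoch_start n l w).
Proof.
rewrite /alive => al.
rewrite epochE lexx /= /epoch_start stay_startS !ltrD2l al /=.
by rewrite jump_clockS ltrDl.
Qed.

Lemma epoch_ex w t : 0 <= t -> exists n l, epoch n l w t.
Proof.
move=> t0; have [n /andP[nt tn]] := partial_sum_locate (S_unbounded w) t0.
have u0 : 0 <= t - S n w by rewrite subr_ge0.
have [l /andP[lu ul]] := partial_sum_locate (E_unbounded n w) u0.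
exists n, l; rewrite epochE tn /= /epoch_start.
by rewrite -lerBrDl lu -ltrBlDl ul.
Qed.

Lemma last_alive n w : exists l, alive n l w /\ ~~ alive n l.+1 w.
Proof.
have [l /andP[l1 l2]] := partial_sum_locate_right (E_unbounded n w) (zeta0 w n).
by exists l; rewrite /alive -leNgt.
Qed.

(** Monotonicity of the partial sums turns an order of times into an order of indices: stays are
    compared first, and jump clocks only within a common stay. *)
Lemma epoch_before n l n' l' w t : epoch n l w t -> t < epoch_end n' l' w ->
  (n < n')%N \/ n = n' /\ (l <= l')%N.
Proof.
rewrite epochE /epoch_end lt_min => /and3P[h1 _ _] /andP[h2 h3].
have : (n < n'.+1)%N.
  apply: (@partial_sum_ltP _ (zeta Z ^~ w)) => //; apply: le_lt_trans h2.
  by apply: le_trans h1; rewrite lerDl jump_clock_ge0.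
rewrite ltnS leq_eqVlt => /orP[/eqP nn|]; [right; split=> //|by left].
have : (l < l'.+1)%N; last by rewrite ltnS.
apply: (@partial_sum_ltP _ (fun l => Defs.eta Z n l w)) => //.
move: h3; rewrite -nn => h3; have := le_lt_trans h1 h3.
by rewrite /epoch_start ltrD2l.
Qed.

Lemma epoch_uniq n l n' l' w t :
  epoch n l w t -> epoch n' l' w t -> (n, l) = (n', l').
Proof.
move=> e e'; have [_ h] := andP e; have [_ h'] := andP e'.
have := epoch_before e h'; have := epoch_before e' h.
move=> [nn|[nn ll]] [nn'|[nn' ll']].
- by move: (ltn_trans nn nn'); rewrite ltnn.
- by move: nn; rewrite nn' ltnn.
- by move: nn'; rewrite nn ltnn.
- by rewrite nn; congr pair; apply/eqP; rewrite eqn_leq ll ll'.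
Qed.

(** Two epochs with a common end both contain the later of their two starts. This will make exits at
    the end of different epochs disjoint events. *)
Lemma epoch_end_inj n l n' l' w : alive n l w -> alive n' l' w ->
  epoch_end n l w = epoch_end n' l' w -> (n, l) = (n', l').
Proof.
move=> a a' ee; have /andP[_ h] := epoch_startP a.
have /andP[_ h'] := epoch_startP a'.
pose t := Num.max (epoch_start n l w) (epoch_start n' l' w).
have tl : t < epoch_end n l w by rewrite gt_max h ee h'.
apply: (@epoch_uniq _ _ _ _ w t).
  by rewrite /epoch tl le_max lexx.
by rewrite /epoch -ee tl le_max lexx orbT.
Qed.

Lemma xi_epoch n l w t : epoch n l w t -> xi Z t w = level n l w.
Proof.
rewrite epochE => /and3P[h1 h2 h3].
have -> : t = S n w + (t - S n w) by ring.
apply: xi_stay; first by rewrite ltrBlDl -stay_startS.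
by apply/andP; split; [rewrite lerBrDl | rewrite ltrBlDl].
Qed.

Lemma st_epoch n l w t : epoch n l w t -> st Z t w = emb Z n w.
Proof.
rewrite epochE => /and3P[h1 h2 h3]; apply: st_path; rewrite -/(S n w) -/(S n.+1 w) h2.
by rewrite andbT (le_trans _ h1)// lerDl jump_clock_ge0.
Qed.

Lemma epoch_end_jump n l w : alive n l.+1 w ->
  epoch_end n l w = epoch_start n l.+1 w.
Proof.
move=> al; apply/min_idPr; rewrite /epoch_start stay_startS lerD2l.
exact: ltW.
Qed.

Lemma epoch_end_trans n l w : ~~ alive n l.+1 w ->
  epoch_end n l w = S n.+1 w.
Proof.
by rewrite /alive -leNgt => al; apply/min_idPl; rewrite stay_startS lerD2l.
Qed.

Lemma xi_end_jump n l w : alive n l.+1 w ->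
  xi Z (epoch_end n l w) w = level n l w + kappa Z n l w.
Proof.
move=> al; rewrite epoch_end_jump// (xi_epoch (epoch_startP al)).
by rewrite /level big_ord_recr/= addrA.
Qed.

Lemma st_end_jump n l w : alive n l.+1 w -> st Z (epoch_end n l w) w = emb Z n w.
Proof. by move=> al; rewrite epoch_end_jump// (st_epoch (epoch_startP al)). Qed.

Lemma xi_end_trans n l w : alive n l w -> ~~ alive n l.+1 w ->
  xi Z (epoch_end n l w) w = level n l w + chi Z n w.
Proof.
move=> a na; rewrite epoch_end_trans//; apply: xi_transition.
by rewrite -/(E n l w) -/(E n l.+1 w) [E n l w < _]a leNgt.
Qed.

Lemma st_end_trans n l w : ~~ alive n l.+1 w ->
  st Z (epoch_end n l w) w = emb Z n.+1 w.
Proof.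
move=> na; rewrite epoch_end_trans//.
have : epoch n.+1 0 w (S n.+1 w).
  by have := epoch_startP (alive0 n.+1 w); rewrite /epoch_start jump_clock0 addr0.
exact: st_epoch.
Qed.

(** * The exit time in terms of epochs *)

Section exit.
Variables (T x : R).
Local Notation I := (`]x - T, x[%classic : set R).
Hypothesis I0 : I 0.

(** For the current stay no [alive] condition is imposed, since it would involve [zeta n] and leave
    the past. Nothing is lost: once (n, l) is alive, so is every (n, l') with l' at most l. *)
Definition inside n l w : Prop :=
  (forall n' l', (n' < n)%N -> alive n' l' w -> I (level n' l' w)) /\
  (forall l', (l' <= l)%N -> I (level n l' w)).

Lemma tau_xi w t : 0 <= t -> (t%:E < tau Z x T w)%E -> I (xi Z t w).
Proof.
rewrite le_eqVlt => /orP[/eqP<- _|t0 tt]; first by rewrite xi0.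
apply: contrapT => nI; move: tt; rewrite ltNge => /negP; apply.
by apply: ereal_inf_lbound; exists t.
Qed.

Lemma inside_end_le_tau n l w : inside n l w ->
  ((epoch_end n l w)%:E <= tau Z x T w)%E.
Proof.
move=> [in1 in2]; apply: le_ereal_inf_tmp => _ [u [u0 uI] <-].
rewrite lee_fin leNgt; apply/negP => uend; apply: uI.
have [n' [l' e]] := epoch_ex w (ltW u0); rewrite (xi_epoch e).
have [nn|[nn ll]] := epoch_before e uend; first exact: in1 (epoch_alive e).
by rewrite nn; exact: in2.
Qed.

(** The right-hand side does not mention t: whether the exit has occurred is constant along an
    epoch. From left to right, every epoch listed in [inside] that is alive starts at or before t,
    and its level is the value of xi at its start. *)
Lemma lt_tauP n l w t : epoch n l w t ->
  (t%:E < tau Z x T w)%E <-> inside n l w.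
Proof.
move=> e; split=> [tt|ins]; last first.
  apply: lt_le_trans (inside_end_le_tau ins).
  by rewrite lte_fin; case/andP: e.
have main n' l' : alive n' l' w -> epoch_start n' l' w <= t -> I (level n' l' w).
  move=> a st'; rewrite -(xi_epoch (epoch_startP a)); apply: tau_xi.
    exact: epoch_start_ge0.
  by apply: le_lt_trans tt; rewrite lee_fin.
have [h1 h2] := andP e; split=> [n' l' nn a|l' ll].
  apply: main => //; apply: le_trans h1.
  have /andP[_ h] := epoch_startP a.
  apply: (@le_trans _ _ (S n'.+1 w)).
    by apply: ltW (lt_le_trans h _); rewrite /epoch_end ge_min lexx.
  apply: (@le_trans _ _ (S n w)); last by rewrite lerDl jump_clock_ge0.
  exact: (partial_sum_le (zeta0 w)).
apply: main; first exact: aliveW (epoch_alive e).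
apply: le_trans h1; rewrite lerD2l; exact: (partial_sum_le (eta0 n w)).
Qed.

Lemma exit_tau n l w : alive n l w -> inside n l w ->
  ~ I (xi Z (epoch_end n l w) w) -> tau Z x T w = (epoch_end n l w)%:E.
Proof.
move=> a ins nI; apply/eqP; rewrite eq_le inside_end_le_tau// andbT.
apply: ereal_inf_lbound; exists (epoch_end n l w) => //; split=> //.
have /andP[_] := epoch_startP a; exact: le_lt_trans (epoch_start_ge0 _ _ _).
Qed.

(** The epoch that contains the exit time is not inside. It must start there, for otherwise its own
    start would precede the exit and make it inside. The exit is then the end of the preceding
    epoch. *)
Lemma exit_ex w : (tau Z x T w < +oo)%E ->
  exists n l, [/\ alive n l w, inside n l w & tau Z x T w = (epoch_end n l w)%:E].
Proof.
move=> tfin; have tau0 : (0 <= tau Z x T w)%E.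
  by apply: le_ereal_inf_tmp => _ [u [u0 _] <-]; rewrite lee_fin ltW.
have tauE : tau Z x T w = (fine (tau Z x T w))%:E.
  by rewrite fineK// ge0_fin_numE.
have t0 : 0 <= fine (tau Z x T w) by exact: fine_ge0.
set t := fine (tau Z x T w) in tauE t0.
have [n [l e]] := epoch_ex w t0.
have nins : ~ inside n l w.
  by move/(lt_tauP e); rewrite tauE ltxx.
have tA : t = epoch_start n l w.
  have /andP[At _] := e; apply/eqP; rewrite eq_le At andbT leNgt; apply/negP => lt.
  apply: nins; apply/(lt_tauP (epoch_startP (epoch_alive e))).
  by rewrite tauE lte_fin.
have prev n' l' : alive n' l' w -> epoch_end n' l' w = t ->
    [/\ alive n' l' w, inside n' l' w & tau Z x T w = (epoch_end n' l' w)%:E].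
  move=> a' et; have e' := epoch_startP a'; split=> //; last by rewrite et.
  apply/(lt_tauP e'); rewrite tauE lte_fin -et.
  by case/andP: e'.
(* The predecessor of (n, l.+1) is (n, l), and that of (n.+1, 0) is the last alive epoch of the stay
   n. The epoch (0, 0) is excluded because its level is 0, a point of the interval. *)
case: l => [|l] in e nins tA *; last first.
  exists n, l; apply: prev; first exact: aliveW (epoch_alive e).
  by rewrite epoch_end_jump ?tA//; exact: epoch_alive e.
case: n => [|n] in e nins tA *.
  exfalso; apply: nins; split=> // l'; rewrite leqn0 => /eqP->.
  by rewrite level00.
have [l [al nal]] := last_alive n w.
exists n, l; apply: prev => //; rewrite epoch_end_trans//.
by rewrite tA /epoch_start jump_clock0 addr0.
Qed.

End exit.
End paths.

Lemma measure_ord_partition {d : measure_display} {T : measurableType d}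
    {R : realType} (mu : {measure set T -> \bar R}) q (X : T -> 'I_q)
    (A : set T) :
  (forall i, measurable [set w | X w = i]) -> measurable A ->
  mu A = (\sum_(i < q) mu (A `&` [set w | X w = i]))%E.
Proof.
move=> mX mA; rewrite -measure_bigsetU_ord//=; last 2 first.
- by move=> i; exact: measurableI.
- by move=> i j _ _ [w [[_ /= <-] [_ /= <-]]].
congr (mu _); rewrite -big_distrr/= -[LHS]setIT; congr (_ `&` _).
apply/esym/seteqP; split=> // w _.
by rewrite -bigcup_seq; exists (X w) => //=; rewrite mem_index_enum.
Qed.

(** * The past of an epoch and its independence of the future *)

Section past.
Context {R : realType} {m : nat} {par : map_param R m}
  {d : measure_display} {Omega : measurableType d}
  {P : 'I_m -> probability Omega R} (Z : map_process par P).
Implicit Types (n l p : nat) (w : Omega) (j : nat -> 'I_m)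
  (Bz Bc : nat -> set (measurableTypeR R))
  (Be Bk : nat -> nat -> set (measurableTypeR R)).

Definition emb_path n j : set Omega :=
  [set w | forall i, (i <= n)%N -> emb Z i w = j i].

Definition box Bz Bc Be Bk : set Omega :=
  [set w | [/\ forall i, Bz i (zeta Z i w), forall i, Bc i (chi Z i w),
               forall i p, Be i p (Defs.eta Z i p w) &
               forall i p, Bk i p (kappa Z i p w)]].

(* Only the variables observed before the start of the epoch (n, l), and
   finitely many of them, are constrained. *)
Definition past_box n l L Bz Bc Be Bk : Prop :=
  [/\ (forall i, measurable (Bz i)) /\ (forall i, measurable (Bc i)),
      (forall i p, measurable (Be i p)) /\ (forall i p, measurable (Bk i p)),
      forall i, (n <= i)%N -> Bz i = setT /\ Bc i = setT &
      forall i p, [|| (n < i)%N, (i == n) && (l <= p)%N | (L <= p)%N] ->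
        Be i p = setT /\ Bk i p = setT].

(** The variables that decide how the epoch (n, l) ends. The whole of [zeta n] is among them,
    including the part already elapsed when the epoch starts. *)
Definition future n l (r : 'I_m) (Bz Be Bk Bc : set (measurableTypeR R)) :
    set Omega :=
  [set w | [/\ emb Z n.+1 w = r, Bz (zeta Z n w), Be (Defs.eta Z n l w),
               Bk (kappa Z n l w) & Bc (chi Z n w)]].

Lemma measurable_future n l r Cz Ce Ck Cc : measurable Cz -> measurable Ce ->
  measurable Ck -> measurable Cc -> measurable (future n l r Cz Ce Ck Cc).
Proof.
move=> mz me mk mc.
rewrite (_ : future _ _ _ _ _ _ _ = [set w | emb Z n.+1 w = r] `&`
  (zeta Z n @^-1` Cz `&` (Defs.eta Z n l @^-1` Ce `&`
  (kappa Z n l @^-1` Ck `&` chi Z n @^-1` Cc)))); last first.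
  apply/seteqP; split=> w /=; first by case.
  by move=> [? [? [? [? ?]]]]; split.
apply: measurableI; first exact: measurable_emb.
apply: measurableI; first by rewrite -[X in measurable X]setTI; exact: measurable_zeta.
apply: measurableI; first by rewrite -[X in measurable X]setTI; exact: measurable_eta.
apply: measurableI; first by rewrite -[X in measurable X]setTI; exact: measurable_kappa.
by rewrite -[X in measurable X]setTI; exact: measurable_chi.
Qed.

(** The joint law is a product, from which the factors of the future split off. The remaining factor
    [V] depends neither on r nor on the future sets, so that it can be identified later by choosing
    these sets full. *)
Lemma future_box (k : 'I_m) n l L j Bz Bc Be Bk :
  past_box n l L Bz Bc Be Bk ->
  exists V : \bar R, forall r Cz Ce Ck Cc,
    measurable Cz -> measurable Ce -> measurable Ck -> measurable Cc ->
    P k (emb_path n j `&` box Bz Bc Be Bk `&` future n l r Cz Ce Ck Cc) =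
    (V * (exponential_prob (nu par (j n)) Cz * exponential_prob (lam par (j n)) Ce *
     jump_law par (j n) Ck * ((ptrans par (j n) r)%:E *
     trans_law par (j n) r Cc)))%E.
Proof.
move=> [[mBz mBc] [mBe mBk] zcT ekT].
pose L' := maxn L l.+1.
have lL : (l < L')%N by rewrite /L' leq_max ltnSn orbT.
pose fac i := (exponential_prob (nu par (j i)) (Bz i) *
  ((ptrans par (j i) (j i.+1))%:E * trans_law par (j i) (j i.+1) (Bc i)) *
  \prod_(p < L') (exponential_prob (lam par (j i)) (Be i p) *
                  jump_law par (j i) (Bk i p)))%E.
exists ((j 0%N == k)%:R%:E * (\prod_(i < n) fac i) *
  \prod_(p < L' | p != Ordinal lL) (exponential_prob (lam par (j n)) (Be n p) *
                  jump_law par (j n) (Bk n p)))%E.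
move=> r Cz Ce Ck Cc mz me mk mc.
(* The constraints of the future are written into the box at the indices n and (n, l), where
   [past_box] imposes none. *)
pose j' i := if (i <= n)%N then j i else r.
pose Bz' i := if i == n then Cz else Bz i.
pose Bc' i := if i == n then Cc else Bc i.
pose Be' i p := if (i == n) && (p == l) then Ce else Be i p.
pose Bk' i p := if (i == n) && (p == l) then Ck else Bk i p.
have -> : emb_path n j `&` box Bz Bc Be Bk `&` future n l r Cz Ce Ck Cc =
    [set w | emb Z 0 w = j' 0%N /\ forall i, (i < n.+1)%N ->
       [/\ emb Z i.+1 w = j' i.+1, Bz' i (zeta Z i w), Bc' i (chi Z i w) &
         forall p, (p < L')%N ->
           Be' i p (Defs.eta Z i p w) /\ Bk' i p (kappa Z i p w)]].
  apply/seteqP; split=> w /=.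
    move=> [[wj [wz wc we wk]] [wr wCz wCe wCk wCc]].
    split; first by rewrite /j' leq0n; exact: wj.
    move=> i; rewrite ltnS => iln; split.
    - rewrite /j'; case: ifPn => [|ni]; first exact: wj.
      have -> : i = n by apply/eqP; rewrite eqn_leq iln leqNgt.
      exact: wr.
    - by rewrite /Bz'; case: eqP => [->//|_]; exact: wz.
    - by rewrite /Bc'; case: eqP => [->//|_]; exact: wc.
    - move=> p pL; rewrite /Be' /Bk'; case: andP => [[/eqP-> /eqP->]//|_].
      by split; [exact: we|exact: wk].
  move=> [w0 wi].
  have [_ wzn wcn wen] := wi n (ltnSn n); have [wel wkl] := wen l lL.
  split; last first.
    have [wr _ _ _] := wi n (ltnSn n).
    move: wr wzn wcn wel wkl.
    rewrite /j' ltnn /Bz' /Bc' /Be' /Bk' !eqxx /=.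
    by split.
  split=> [[|i] iln|].
  - by rewrite w0.
  - have [-> _ _ _] := wi i (ltnW iln); by rewrite /j' iln.
  - split=> [i|i|i p|i p].
    + have [ni|iln] := leqP n i; first by have [-> _] := zcT i ni.
      have [_ + _ _] := wi i (ltnW iln); by rewrite /Bz' ltn_eqF.
    + have [ni|iln] := leqP n i; first by have [_ ->] := zcT i ni.
      have [_ _ + _] := wi i (ltnW iln); by rewrite /Bc' ltn_eqF.
    + have [/ekT[-> _]//|] := boolP [|| (n < i)%N, (i == n) && (l <= p)%N | (L <= p)%N].
      rewrite !negb_or -!leqNgt -!ltnNge => /and3P[iln ip pL].
      have pL' : (p < L')%N by rewrite /L' leq_max pL.
      have [_ _ _ /(_ p pL')[+ _]] := wi i iln.
      rewrite /Be'; case: andP => // -[/eqP ii /eqP pl].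
      by move: ip; rewrite ii pl eqxx leqnn.
    + have [/ekT[_ ->]//|] := boolP [|| (n < i)%N, (i == n) && (l <= p)%N | (L <= p)%N].
      rewrite !negb_or -!leqNgt -!ltnNge => /and3P[iln ip pL].
      have pL' : (p < L')%N by rewrite /L' leq_max pL.
      have [_ _ _ /(_ p pL')[_ +]] := wi i iln.
      rewrite /Bk'; case: andP => // -[/eqP ii /eqP pl].
      by move: ip; rewrite ii pl eqxx leqnn.
rewrite driving_law; last 4 first.
- by move=> i; rewrite /Bz'; case: ifP.
- by move=> i; rewrite /Bc'; case: ifP.
- by move=> i p; rewrite /Be'; case: ifP.
- by move=> i p; rewrite /Bk'; case: ifP.
rewrite big_ord_recr/= (bigD1 (Ordinal lL))//=.
have -> : (\prod_(i < n) (exponential_prob (nu par (j' i)) (Bz' i) *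
    ((ptrans par (j' i) (j' i.+1))%:E * trans_law par (j' i) (j' i.+1) (Bc' i)) *
    \prod_(p < L') (exponential_prob (lam par (j' i)) (Be' i p) *
       jump_law par (j' i) (Bk' i p))) = \prod_(i < n) fac i)%E.
  apply: eq_bigr => i _; rewrite /fac /j' (ltnW (ltn_ord i)) (ltn_ord i).
  rewrite /Bz' /Bc' ltn_eqF//; congr (_ * _)%E; apply: eq_bigr => p _.
  by rewrite /Be' /Bk' ltn_eqF.
have -> : (\prod_(p < L' | p != Ordinal lL)
    (exponential_prob (lam par (j' n)) (Be' n p) * jump_law par (j' n) (Bk' n p)) =
  \prod_(p < L' | p != Ordinal lL)
    (exponential_prob (lam par (j n)) (Be n p) * jump_law par (j n) (Bk n p)))%E.
  apply: eq_bigr => p pl; rewrite /j' leqnn /Be' /Bk' eqxx/=.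
  by rewrite ifN// ifN.
rewrite /j' /Bz' /Bc' /Be' /Bk' !eqxx leq0n leqnn ltnn /=.
set a := (_%:R%:E); set b := (\prod_(i < n) _)%E; set c := (\prod_(p < L' | _) _)%E.
rewrite -!muleA; congr (_ * (_ * _))%E; rewrite !muleA.
set z := exponential_prob _ Cz; set p := (ptrans _ _ _)%:E.
set t := trans_law _ _ _ _; set e := exponential_prob _ Ce; set q := jump_law _ _ _.
by rewrite [LHS]muleC !muleA (muleAC _ t e) (muleAC _ p e) (muleAC _ t q) (muleAC _ p q).
Qed.

(** The empty set is added for stability under intersection: boxes attached to different paths of
    the chain are disjoint. *)
Definition past_gen n l : set (set Omega) :=
  [set A | A = set0 \/ exists j L Bz Bc Be Bk, past_box n l L Bz Bc Be Bk /\
     A = emb_path n j `&` box Bz Bc Be Bk].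

Lemma past_genI n l : setI_closed (past_gen n l).
Proof.
move=> A B [->|[j [L [Bz [Bc [Be [Bk [[[mBz mBc] [mBe mBk] zc ek] ->]]]]]]]].
  by move=> _; left; rewrite set0I.
move=> [->|[j' [L' [Bz' [Bc' [Be' [Bk' [[[mBz' mBc'] [mBe' mBk'] zc' ek'] ->]]]]]]]].
  by left; rewrite setI0.
have [jj'|jj'] := pselect (forall i, (i <= n)%N -> j i = j' i); last first.
  left; rewrite -subset0 => w [[wj _] [wj' _]]; apply: jj' => i iln.
  by rewrite -wj// -wj'.
right; exists j, (maxn L L'), (fun i => Bz i `&` Bz' i), (fun i => Bc i `&` Bc' i),
  (fun i p => Be i p `&` Be' i p), (fun i p => Bk i p `&` Bk' i p); split.
  split.
  - by split=> i; exact: measurableI.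
  - by split=> i p; exact: measurableI.
  - by move=> i ni; have [-> ->] := zc i ni; have [-> ->] := zc' i ni; rewrite !setIT.
  - move=> i p; rewrite geq_max => h.
    have [|-> ->] := ek i p.
      by move: h => /or3P[->//|->|/andP[-> _]]; rewrite ?orbT.
    have [|-> ->] := ek' i p; last by rewrite !setIT.
    by move: h => /or3P[->//|->|/andP[_ ->]]; rewrite ?orbT.
apply/seteqP; split=> w.
  move=> [[wj [a1 a2 a3 a4]] [_ [b1 b2 b3 b4]]]; split=> //.
move=> [wj [a1 a2 a3 a4]]; split; split.
- exact: wj.
- by split; [move=> i; case: (a1 i)|move=> i; case: (a2 i)
            |move=> i p; case: (a3 i p)|move=> i p; case: (a4 i p)].
- by move=> i iln; rewrite -jj'// wj.
- by split; [move=> i; case: (a1 i)|move=> i; case: (a2 i)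
            |move=> i p; case: (a3 i p)|move=> i p; case: (a4 i p)].
Qed.

Lemma measurable_emb_path n j : measurable (emb_path n j).
Proof.
rewrite (_ : emb_path n j = \bigcap_i
    (if (i <= n)%N then [set w | emb Z i w = j i] else setT)); last first.
  apply/seteqP; split=> w /= h i; first by move=> _; case: ifPn => //; exact: h.
  by move=> iln; have := h i Logic.I; rewrite iln.
apply: bigcapT_measurable => i; case: ifP => _ //; exact: measurable_emb.
Qed.

Lemma measurable_box Bz Bc Be Bk :
  (forall i, measurable (Bz i)) -> (forall i, measurable (Bc i)) ->
  (forall i p, measurable (Be i p)) -> (forall i p, measurable (Bk i p)) ->
  measurable (box Bz Bc Be Bk).
Proof.
move=> mz mc me mk.
rewrite (_ : box _ _ _ _ = (\bigcap_i (zeta Z i @^-1` Bz i)) `&`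
   (\bigcap_i (chi Z i @^-1` Bc i)) `&`
   (\bigcap_i \bigcap_p (Defs.eta Z i p @^-1` Be i p)) `&`
   (\bigcap_i \bigcap_p (kappa Z i p @^-1` Bk i p))); last first.
  apply/seteqP; split=> w /=.
    by move=> [a1 a2 a3 a4]; split; [split; [split|]|]; do ?move=> ? _.
  move=> [[[a1 a2] a3] a4]; split=> *; [exact: a1|exact: a2|exact: a3|exact: a4].
apply: measurableI; [apply: measurableI; [apply: measurableI|]|].
- apply: bigcapT_measurable => i; rewrite -[X in measurable X]setTI.
  exact: (measurable_zeta Z i measurableT (mz i)).
- apply: bigcapT_measurable => i; rewrite -[X in measurable X]setTI.
  exact: (measurable_chi Z i measurableT (mc i)).
- apply: bigcapT_measurable => i; apply: bigcapT_measurable => p.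
  rewrite -[X in measurable X]setTI.
  exact: (measurable_eta Z i p measurableT (me i p)).
- apply: bigcapT_measurable => i; apply: bigcapT_measurable => p.
  rewrite -[X in measurable X]setTI.
  exact: (measurable_kappa Z i p measurableT (mk i p)).
Qed.

Lemma past_gen_measurable n l A : past_gen n l A -> measurable A.
Proof.
move=> [->//|[j [L [Bz [Bc [Be [Bk [[[mBz mBc] [mBe mBk] _ _] ->]]]]]]]].
by apply: measurableI; [exact: measurable_emb_path|exact: measurable_box].
Qed.

(** The sample space with the coarser sigma-algebra, so that being determined by the past is plain
    measurability on this type. *)
Definition pastT n l := g_sigma_algebraType (past_gen n l).

Lemma past_sub n l (A : set (pastT n l)) : measurable A -> d.-measurable (A : set Omega).
Proof.
apply: smallest_sub; first exact: sigma_algebra_measurable.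
exact: past_gen_measurable.
Qed.

Lemma measurable_past_id n l : measurable_fun setT (id : Omega -> pastT n l).
Proof. by move=> _ A mA; rewrite setTI; exact: past_sub mA. Qed.

Lemma past_box_setT n l :
  past_box n l 0 (fun=> setT) (fun=> setT) (fun _ _ => setT) (fun _ _ => setT).
Proof. by split. Qed.

Lemma box_setT : box (fun=> setT) (fun=> setT) (fun _ _ => setT) (fun _ _ => setT) = setT.
Proof. by apply/seteqP; split. Qed.

Lemma past_gen_emb_path n l j : past_gen n l (emb_path n j).
Proof.
right; exists j, 0%N, (fun=> setT), (fun=> setT), (fun _ _ => setT), (fun _ _ => setT).
by split; [exact: past_box_setT|rewrite box_setT setIT].
Qed.

(** The chain has finitely many paths up to time n. Listed through their codes, they give the
    countable cover by generators that uniqueness of measures demands. *)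
Lemma emb_path_cover n : exists g : nat -> set Omega,
  (forall q, g q = set0 \/ exists j, g q = emb_path n j) /\ \bigcup_q g q = setT.
Proof.
exists (fun q => if @unpickle {ffun 'I_n.+1 -> 'I_m} q is Some f
                then emb_path n (fun i => f (inord i)) else set0); split.
  by move=> q; case: unpickle => [f|]; [right; eexists|left].
apply/seteqP; split=> // w _.
exists (pickle [ffun i : 'I_n.+1 => emb Z i w]) => //.
by rewrite pickleK /= => i iln; rewrite ffunE inordK.
Qed.

(** As functions of [A], both sides are finite measures on the past. They agree on the generators by
    [future_box], hence everywhere. Fixing the state j at step n makes the factor of the future the
    same for all generators. *)
Lemma future_indep (k : 'I_m) n l (j r : 'I_m) Cz Ce Ck Cc (A : set (pastT n l)) :
  measurable Cz -> measurable Ce -> measurable Ck -> measurable Cc ->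
  measurable A ->
  P k (A `&` [set w | emb Z n w = j] `&` future n l r Cz Ce Ck Cc) =
  (P k (A `&` [set w | emb Z n w = j]) *
   (exponential_prob (nu par j) Cz * exponential_prob (lam par j) Ce *
     jump_law par j Ck * ((ptrans par j r)%:E * trans_law par j r Cc)))%E.
Proof.
move=> mz me mk mc.
have mD : measurable [set w | emb Z n w = j] by exact: measurable_emb.
have mF : measurable ([set w | emb Z n w = j] `&` future n l r Cz Ce Ck Cc).
  by apply: measurableI => //; exact: measurable_future.
set c := (exponential_prob _ _ * _ * _ * _)%E.
have cE : c = (expo (nu_gt0 par j) Cz * expo (lam_gt0 par j) Ce *
     jump_law par j Ck * ((ptrans par j r)%:E * trans_law par j r Cc))%E by [].
have c0 : (0 <= c)%E.
  by rewrite cE !mule_ge0// lee_fin ptrans_ge0.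
have cfin : c \is a fin_num by rewrite cE !fin_numM// fin_num_measure.
have fc0 : 0 <= fine c by exact: fine_ge0.
have mid := @measurable_past_id n l.
pose m1 : {measure set (pastT n l) -> \bar R} := image_measure (mrestr (P k) mF) mid.
pose m2 : {measure set (pastT n l) -> \bar R} := mscale (NngNum fc0) (image_measure (mrestr (P k) mD) mid).
have [g [gE gT]] := emb_path_cover n.
suff m12 (B : set (pastT n l)) : measurable B -> m1 B = m2 B.
  move=> mA; have := m12 A mA.
  rewrite /m1 /m2 /= /mscale /= /image_measure /pushforward /= /mrestr /=.
  by rewrite fineK// setIA muleC.
apply: (@measure_unique _ R (pastT n l) (past_gen n l) g erefl
  (@past_genI n l) _ gT m1 m2).
- by move=> q; have [->|[i ->]] := gE q; [left|exact: past_gen_emb_path].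
- move=> B' [->|[i [L [Bz [Bc [Be [Bk [pb ->]]]]]]]]; first by rewrite !measure0.
  rewrite /m1 /m2 /= /mscale /= /image_measure /pushforward /= /mrestr /=.
  rewrite fineK// !preimage_id.
  have [ij|ij] := eqVneq (i n) j; last first.
    have emp C : emb_path n i `&` box Bz Bc Be Bk `&`
        ([set w | emb Z n w = j] `&` C) = set0.
      rewrite -subset0 => w [[wi _] [/= wj _]].
      by move/eqP: ij; apply; rewrite -wi// wj.
    by rewrite emp -[X in _ `&` X]setIT emp !measure0 mule0.
  have sub C : emb_path n i `&` box Bz Bc Be Bk `&`
        ([set w | emb Z n w = j] `&` C) = emb_path n i `&` box Bz Bc Be Bk `&` C.
    apply/seteqP; split=> w /=; first by move=> [? []].
    by move=> [[wi wB] wC]; split=> //; split=> //; rewrite wi.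
  rewrite sub -[X in (_ * P k (_ `&` X))%E]setIT sub setIT.
  have [V HV] := future_box k i pb.
  (* With full future sets only p_{jr} is left beside V, and summing over r gives V itself. *)
  have -> : P k (emb_path n i `&` box Bz Bc Be Bk) = V.
    rewrite (measure_ord_partition (P k) (measurable_emb Z n.+1)); last first.
      have [[? ?] [? ?] _ _] := pb.
      by apply: measurableI; [exact: measurable_emb_path|exact: measurable_box].
    rewrite (eq_bigr (fun q => V * (ptrans par (i n) q)%:E)%E) => [|q _]; last first.
      rewrite (_ : _ `&` _ = emb_path n i `&` box Bz Bc Be Bk `&`
          future n l q setT setT setT setT); last first.
        by apply/seteqP; split=> w /= [wi]; [move=> we; split|case; split].
      have := HV q _ _ _ _ (@measurableT _ _) (@measurableT _ _) (@measurableT _ _) (@measurableT _ _).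
      rewrite -[exponential_prob (nu _ _) _]/(expo (nu_gt0 par (i n)) setT).
      rewrite -[exponential_prob (lam _ _) _]/(expo (lam_gt0 par (i n)) setT).
      by rewrite !probability_setT !mule1 mul1e => <-.
    rewrite -ge0_sume_distrr; last by move=> q _; rewrite lee_fin ptrans_ge0.
    by rewrite sumEFin ptrans_sum1 mule1.
  by rewrite HV// muleC ij.
- move=> q; apply: le_lt_trans (ltry 1); apply: probability_le1.
  apply: measurableI => //; rewrite preimage_id.
  by have [->|[i ->]] := gE q; [exact: measurable0|exact: measurable_emb_path].
Qed.

(** A generator includes a path of the chain, so a condition on the other variables is a generator
    only after intersection with such a path; the countable cover glues the pieces together. *)
Lemma past_measurable n l (A : set (pastT n l)) :
  (forall j, past_gen n l (emb_path n j `&` A)) -> measurable A.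
Proof.
move=> GA; have [g [gE gT]] := emb_path_cover n.
rewrite -[A]setTI -gT setI_bigcupl; apply: bigcup_measurable => q _.
have [->|[j ->]] := gE q; first by rewrite set0I.
by apply: sub_sigma_algebra; exact: GA.
Qed.

Lemma past_measurable_fun n l (f : Omega -> R) :
  (forall B : set (measurableTypeR R), measurable B ->
    exists L Bz Bc Be Bk,
    past_box n l L Bz Bc Be Bk /\ f @^-1` B = box Bz Bc Be Bk) ->
  measurable_fun setT (f : pastT n l -> R).
Proof.
move=> fB _ B mB; rewrite setTI; apply: past_measurable => j; right.
have [L [Bz [Bc [Be [Bk [pb ->]]]]]] := fB B mB.
by exists j, L, Bz, Bc, Be, Bk.
Qed.

Lemma past_zeta n l i : (i < n)%N ->
  measurable_fun setT (zeta Z i : pastT n l -> R).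
Proof.
move=> iln; apply: past_measurable_fun => B mB.
exists 0%N, (fun i' => if i' == i then B else setT), (fun=> setT),
  (fun _ _ => setT), (fun _ _ => setT); split; first split=> //.
- by split=> // i'; case: ifP.
- by move=> i' ni'; rewrite ifN// gtn_eqF// (leq_trans iln).
apply/seteqP; split=> w /=; first by move=> wB; split=> // i'; case: eqP => // ->.
by move=> [/(_ i)]; rewrite eqxx.
Qed.

Lemma past_chi n l i : (i < n)%N ->
  measurable_fun setT (chi Z i : pastT n l -> R).
Proof.
move=> iln; apply: past_measurable_fun => B mB.
exists 0%N, (fun=> setT), (fun i' => if i' == i then B else setT),
  (fun _ _ => setT), (fun _ _ => setT); split; first split=> //.
- by split=> // i'; case: ifP.
- by move=> i' ni'; rewrite ifN// gtn_eqF// (leq_trans iln).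
apply/seteqP; split=> w /=; first by move=> wB; split=> // i'; case: eqP => // ->.
by move=> [_ /(_ i)]; rewrite eqxx.
Qed.

Let past_idx n l i p i' p' : (i < n)%N || (i == n) && (p < l)%N ->
  [|| (n < i')%N, (i' == n) && (l <= p')%N | (p.+1 <= p')%N] ->
  (i' == i) && (p' == p) = false.
Proof.
move=> h h'; apply/negbTE/negP => /andP[/eqP ii /eqP pp].
move: h h'; rewrite ii pp ltnn orbF.
by case: (ltngtP i n) => //= _; rewrite ltnNge => /negbTE->.
Qed.

Lemma past_eta n l i p : (i < n)%N || (i == n) && (p < l)%N ->
  measurable_fun setT (Defs.eta Z i p : pastT n l -> R).
Proof.
move=> ip; apply: past_measurable_fun => B mB.
exists p.+1, (fun=> setT), (fun=> setT),
  (fun i' p' => if (i' == i) && (p' == p) then B else setT), (fun _ _ => setT).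
split; first split=> //.
- by split=> // i' p'; case: ifP.
- by move=> i' p' h; rewrite (past_idx ip h).
apply/seteqP; split=> w /=.
  by move=> wB; split=> // i' p'; case: andP => // -[/eqP-> /eqP->].
by move=> [_ _ /(_ i p)]; rewrite !eqxx.
Qed.

Lemma past_kappa n l i p : (i < n)%N || (i == n) && (p < l)%N ->
  measurable_fun setT (kappa Z i p : pastT n l -> R).
Proof.
move=> ip; apply: past_measurable_fun => B mB.
exists p.+1, (fun=> setT), (fun=> setT), (fun _ _ => setT),
  (fun i' p' => if (i' == i) && (p' == p) then B else setT).
split; first split=> //.
- by split=> // i' p'; case: ifP.
- by move=> i' p' h; rewrite (past_idx ip h).
apply/seteqP; split=> w /=.
  by move=> wB; split=> // i' p'; case: andP => // -[/eqP-> /eqP->].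
by move=> [_ _ _ /(_ i p)]; rewrite !eqxx.
Qed.

Lemma past_stay_start n l i : (i <= n)%N ->
  measurable_fun setT (stay_start Z i : pastT n l -> R).
Proof.
move=> iln; apply: measurable_sum => q; apply: past_zeta.
exact: leq_trans iln.
Qed.

Lemma past_jump_clock n l i p : (i < n)%N || (i == n) && (p <= l)%N ->
  measurable_fun setT (jump_clock Z i p : pastT n l -> R).
Proof.
move=> ip; apply: measurable_sum => q; apply: past_eta.
by move: ip => /orP[->//|/andP[-> pl]]; rewrite (leq_trans _ pl) ?orbT.
Qed.

Lemma past_alive n l i p : (i < n)%N ->
  measurable ([set w | alive Z i p w] : set (pastT n l)).
Proof.
move=> iln.
have mlt : measurable_fun setT
    (fun w : pastT n l => jump_clock Z i p w < zeta Z i w).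
  apply: measurable_fun_ltr; last exact: past_zeta.
  by apply: past_jump_clock; rewrite iln.
by rewrite -[X in measurable X]setTI; exact: (mlt measurableT [set true]).
Qed.

(** The value of xi at the start of a stay is known by recursion only: it is the level of the last
    alive epoch of the preceding stay plus the transition jump. Which epoch is the last is
    determined by the past, because that stay is over. *)
Lemma past_level n l i p : (i < n)%N || (i == n) && (p <= l)%N ->
  measurable_fun setT (level Z i p : pastT n l -> R).
Proof.
move=> ip.
have xiS q : (q <= n)%N ->
    measurable_fun setT ((fun w => xi Z (stay_start Z q w) w) : pastT n l -> R).
  elim: q => [_|q IH qn].
    rewrite (_ : (fun _ => _) = cst 0)//; apply/funext => w.
    by rewrite stay_start0 xi0.
  have IHq := IH (ltnW qn).
  move=> _ B mB; rewrite setTI.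
  rewrite (_ : _ @^-1` B = \bigcup_u (([set w | alive Z q u w] `\`
      [set w | alive Z q u.+1 w]) `&`
     ((fun w => level Z q u w + chi Z q w) @^-1` B))); last first.
    apply/seteqP; split=> w.
      move=> wB; have [u [a na]] := last_alive Z q w.
      exists u => //; split; first by split=> //; exact/negP.
      by rewrite /preimage/= -(xi_end_trans a na) epoch_end_trans.
    move=> [u _ [[a /negP na]]].
    by rewrite /preimage/= -(xi_end_trans a na) epoch_end_trans.
  apply: bigcup_measurable => u _; apply: measurableI.
    by apply: measurableD; exact: past_alive.
  rewrite -[X in measurable X]setTI; apply: measurable_funD => //; last exact: past_chi.
  apply: measurable_funD => //; apply: measurable_sum => v.
  by apply: past_kappa; rewrite qn.
apply: measurable_funD.
  by apply: xiS; move: ip => /orP[/ltnW//|/andP[/eqP->]].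
apply: measurable_sum => q; apply: past_kappa.
by move: ip => /orP[->//|/andP[-> pl]]; rewrite (leq_trans _ pl) ?orbT.
Qed.

Lemma past_inside n l T x : measurable ([set w | inside Z T x n l w] : set (pastT n l)).
Proof.
rewrite (_ : [set w | _] = (\bigcap_i \bigcap_p
     (if (i < n)%N then ~` [set w | alive Z i p w] `|`
        level Z i p @^-1` `]x - T, x[%classic else setT)) `&`
   (\bigcap_p (if (p <= l)%N then level Z n p @^-1` `]x - T, x[%classic
       else setT))); last first.
  apply/seteqP; split=> w.
    move=> [i1 i2]; split=> [i _ p _|p _].
      case: ifPn => // iln; have [a|na] := boolP (alive Z i p w); last by left; exact/negP.
      by right; exact: i1.
    by case: ifPn => // pl; exact: i2.
  move=> [i1 i2]; split=> [i p iln a|p pl].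
    have := i1 i Logic.I p Logic.I; rewrite iln => -[|//].
    by move=> /(_ a).
  by have := i2 p Logic.I; rewrite pl.
apply: measurableI; last first.
  apply: bigcapT_measurable => p; case: ifPn => // pl.
  rewrite -[X in measurable X]setTI; apply: past_level => //.
  by rewrite eqxx pl orbT.
apply: bigcapT_measurable => i; apply: bigcapT_measurable => p; case: ifPn => // iln.
apply: measurableU; first by apply: measurableC; exact: past_alive.
rewrite -[X in measurable X]setTI; apply: past_level => //.
by rewrite iln.
Qed.

End past.

(** * Measurability of comparisons and integrals over products *)

Section measurable_comparison.
Context {d : measure_display} {T : measurableType d} {R : realType}.
Variables f g : T -> R.
Hypotheses (mf : measurable_fun setT f) (mg : measurable_fun setT g).

Lemma measurable_lt_set : measurable [set x | f x < g x].
Proof.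
rewrite -[X in measurable X]setTI.
by have := measurable_fun_ltr mf mg; apply.
Qed.

Lemma measurable_le_set : measurable [set x | f x <= g x].
Proof.
rewrite -[X in measurable X]setTI.
by have := measurable_fun_ler mf mg; apply.
Qed.

End measurable_comparison.

Lemma integral_prod_indic {d1 d2 : measure_display} {T1 : measurableType d1}
    {T2 : measurableType d2} {R : realType} (m1 : probability T1 R)
    (m2 : probability T2 R) (f : T1 -> \bar R) (B : set T2) :
  measurable_fun setT f -> (forall x, 0 <= f x)%E -> measurable B ->
  (\int[m1 \x m2]_p (f p.1 * (\1_B p.2)%:E) = (\int[m1]_x f x) * m2 B)%E.
Proof.
move=> mf f0 mB.
have mind : measurable_fun setT (fun y : T2 => (\1_B y)%:E : \bar R).
  exact/measurable_EFinP.
rewrite fubini_tonelli1; last 2 first.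
- apply: emeasurable_funM; first exact: (measurableT_comp mf measurable_fst).
  exact: (measurableT_comp mind measurable_snd).
- by move=> p; rewrite mule_ge0// lee_fin.
rewrite -ge0_integralZr//.
apply: eq_integral => x _; rewrite /fubini_F/=.
by rewrite ge0_integralZl// integral_indic// setIT.
Qed.

(** * Competing exponential clocks *)

Section exponential_clocks.
Context {R : realType}.
Local Notation RT := (measurableTypeR R).

(** Values on the negative half-line and at the single point u are free, both sets being null.
    Strict and weak inequalities between clocks can thus be treated alike. *)
Lemma integral_expo_tail (a b c u : R) (a0 : 0 < a) (g : RT -> \bar R) :
  0 <= b -> 0 <= c -> 0 <= u -> measurable_fun setT g ->
  (forall t, 0 <= t -> t < u -> g t = 0%E) ->
  (forall t, u < t -> g t = (c * expR (- (b * t)))%:E) ->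
  (\int[expo a0]_t g t = (c * (a / (a + b) * expR (- ((a + b) * u))))%:E)%E.
Proof.
move=> b0 c0 u0 mg glt ggt.
have mexp : measurable_fun setT (fun t : RT => (expR (- (b * t)))%:E : \bar R).
  apply/measurable_EFinP; apply: (measurableT_comp (@measurable_expR R)).
  by apply: (measurableT_comp (@oppr_measurable R setT)); apply: measurable_funM.
rewrite EFinM -integral_expR_expo// -ge0_integralZl_EFin//; last first.
  exact: measurable_funTS.
rewrite [in RHS]integral_mkcond; apply: ae_eq_integral => //.
  apply/(measurable_restrictT _ _).1 => //; apply: measurable_funTS.
  exact: emeasurable_funM.
exists (`]-oo, 0%R[%classic `|` [set u]); split; first exact: measurableU.
  apply/eqP; rewrite -measure_le0.
  apply: le_trans (measureU2 _ _ _) _ => //.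
  rewrite -[leRHS]adde0; apply: leeD; rewrite le_eqVlt; apply/orP; left; apply/eqP.
    exact (expo_lt0 a0).
  exact (expo_set1 a0 u).
move=> t /= /not_implyP[_ gt]; rewrite in_itv/=.
have [t0|t0] := ltP t 0; first by left.
right; apply: contrapT => /eqP tu; apply: gt.
rewrite /patch; case: ifPn; rewrite ?inE ?notin_setE/= in_itv/= andbT.
  by move=> ut; rewrite ggt ?EFinM// lt_neqAle eq_sym tu.
by move=> /negP; rewrite -ltNge => ut; exact: glt.
Qed.

Definition expo2 (a b : R) (a0 : 0 < a) (b0 : 0 < b) :
  probability (RT * RT)%type R := (expo a0 \x expo b0)%E.

(* In the next three lemmas the sojourn time p.1 (rate a) and the waiting
   time p.2 for the next jump (rate b) compete after the jump clock shows e. *)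
Lemma integral_jump_first (a b s r e : R) (a0 : 0 < a) (b0 : 0 < b) : 0 < s ->
  0 <= e ->
  (\int[expo a0 \x expo b0]_p
     (\1_[set p : RT * RT | (e + p.2 < p.1)%R] p *
      expR (- (s * (r + e + p.2))))%:E =
   (b / (a + b + s) * expR (- (s * (r + e)) - a * e))%:E)%E.
Proof.
move=> s0 e0.
have mS : measurable [set p : RT * RT | e + p.2 < p.1].
  by apply: measurable_lt_set => //; apply: measurable_funD.
have mf : measurable_fun setT (fun p : RT * RT =>
    (\1_[set p : RT * RT | (e + p.2 < p.1)%R] p *
      expR (- (s * (r + e + p.2))))%:E).
  apply/measurable_EFinP; apply: measurable_funM => //.
  apply: (measurableT_comp (@measurable_expR R)).
  apply: (measurableT_comp (@oppr_measurable R setT)).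
  by apply: measurable_funM => //; apply: measurable_funD.
rewrite fubini_tonelli2//.
(* The sojourn time is integrated first: it exceeds e + h with probability e^{-a (e + h)}, and the
   part in h joins the discount to form the rate a + s. *)
rewrite (@integral_expo_tail b (a + s) (expR (- (s * (r + e)) - a * e)) 0)//.
- rewrite mulr0 oppr0 expR0 mulr1 mulrC (_ : b + (a + s) = a + b + s)//; ring.
- by rewrite addr_ge0// ltW.
- exact: measurable_fun_fubini_tonelli_G.
- by move=> t t0; rewrite ltNge t0.
move=> h h0; rewrite /fubini_G.
rewrite (@integral_expo_tail a 0 (expR (- (s * (r + e + h)))) (e + h))//.
- rewrite addr0 divff ?gt_eqF// mul1r -!expRD; congr (expR _)%:E; ring.
- by rewrite addr_ge0// ltW.
- exact: (measurableT_comp mf (measurable_pair2 _)).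
- by move=> t t0 tu; rewrite indicE memNset ?mul0r//= => /(lt_trans tu); rewrite ltxx.
- by move=> t tu; rewrite indicE mem_set// mul1r mul0r oppr0 expR0 mulr1.
Qed.

Lemma integral_stay_first (a b s r e : R) (a0 : 0 < a) (b0 : 0 < b) : 0 < s ->
  0 <= e ->
  (\int[expo a0 \x expo b0]_p
     (\1_[set p : RT * RT | (e < p.1)%R /\ (p.1 <= e + p.2)%R] p *
      expR (- (s * (r + p.1))))%:E =
   (a / (a + b + s) * expR (- (s * (r + e)) - a * e))%:E)%E.
Proof.
move=> s0 e0.
have mS : measurable [set p : RT * RT | (e < p.1)%R /\ (p.1 <= e + p.2)%R].
  apply: (@measurableI _ _ [set p : RT * RT | e < p.1] [set p | p.1 <= e + p.2]).
    exact: measurable_lt_set.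
  by apply: measurable_le_set => //; apply: measurable_funD.
have mf : measurable_fun setT (fun p : RT * RT =>
    (\1_[set p : RT * RT | (e < p.1)%R /\ (p.1 <= e + p.2)%R] p *
      expR (- (s * (r + p.1))))%:E).
  apply/measurable_EFinP; apply: measurable_funM => //.
  apply: (measurableT_comp (@measurable_expR R)).
  apply: (measurableT_comp (@oppr_measurable R setT)).
  by apply: measurable_funM => //; apply: measurable_funD.
rewrite fubini_tonelli1//.
(* Here the waiting time is integrated first: it is at least t - e with probability e^{-b (t - e)},
   whence the rate b + s and the constant b e in the exponent. *)
rewrite (@integral_expo_tail a (b + s) (expR (- (s * r) + b * e)) e)//.
- rewrite mulrCA -expRD (_ : a + (b + s) = a + b + s); last by ring.
  congr ((_ * expR _)%:E); ring.
- by rewrite addr_ge0// ltW.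
- exact: measurable_fun_fubini_tonelli_F.
- move=> t t0 te; rewrite /fubini_F integral0_eq// => h _.
  by rewrite indicE memNset ?mul0r//= => -[/(lt_trans te)]; rewrite ltxx.
move=> t et; rewrite /fubini_F.
rewrite (@integral_expo_tail b 0 (expR (- (s * (r + t)))) (t - e))//.
- rewrite addr0 divff ?gt_eqF// mul1r -!expRD; congr (expR _)%:E; ring.
- by rewrite subr_ge0 ltW.
- exact: (measurableT_comp mf (measurable_pair1 _)).
- move=> h h0 ht; rewrite indicE memNset ?mul0r//= => -[_].
  by rewrite leNgt -ltrBrDl ht.
- move=> h ht; rewrite indicE mem_set ?mul1r ?mul0r ?oppr0 ?expR0 ?mulr1//=.
  by split=> //; rewrite -lerBlDl ltW.
Qed.

Lemma integral_epoch_length (a b s r e : R) (a0 : 0 < a) (b0 : 0 < b)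
    (s0 : 0 < s) : 0 <= r -> 0 <= e ->
  (\int[expo a0 \x expo b0]_p
     expo s0 [set t : RT | [/\ r + e <= t, t < r + p.1 & t < r + e + p.2]%R] =
   (s / (a + b + s) * expR (- (s * (r + e)) - a * e))%:E)%E.
Proof.
move=> r0 e0; have re0 : 0 <= r + e by exact: addr_ge0.
pose A := [set q : (RT * RT) * RT |
  [/\ r + e <= q.2, q.2 < r + q.1.1 & q.2 < r + e + q.1.2]].
have mA : measurable A.
  rewrite (_ : A = [set q | r + e <= q.2] `&` ([set q | q.2 < r + q.1.1] `&`
     [set q | q.2 < r + e + q.1.2])); last first.
    apply/seteqP; split=> q; [by case|by move=> [? []]].
  apply: measurableI; first exact: measurable_le_set.
  apply: measurableI; apply: measurable_lt_set => //; apply: measurable_funD => //.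
    exact: (measurableT_comp measurable_fst).
  exact: (measurableT_comp measurable_snd).
have mind : measurable_fun setT (fun q : (RT * RT) * RT => (\1_A q)%:E : \bar R).
  exact/measurable_EFinP.
transitivity (\int[expo a0 \x expo b0]_p \int[expo s0]_t (\1_A (p, t))%:E)%E.
  apply: eq_integral => p _; set B := [set t | _].
  have -> : (fun t => (\1_A (p, t))%:E) = (fun t => (\1_B t)%:E) :> (RT -> \bar R).
    apply/funext => t; rewrite !indicE.
    by have -> : ((p, t) \in A) = (t \in B) by apply/idP/idP; rewrite !inE.
  rewrite integral_indic ?setIT//.
  rewrite (_ : B = xsection A p); first exact: measurable_xsection.
  by apply/seteqP; split=> t; rewrite /xsection/= inE.
transitivity (\int[expo s0]_t \int[expo2 a0 b0]_p (\1_A (p, t))%:E)%E.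
  exact: (@fubini_tonelli _ _ _ _ _ (expo2 a0 b0) (expo s0) (fun q => (\1_A q)%:E)).
(* For fixed t > r + e both clocks are still running with probability e^{-a (t - r) - b (t - r -
   e)}; the terms free of t give the constant. *)
rewrite (@integral_expo_tail s (a + b) (expR (a * r + b * (r + e))) (r + e))//.
- rewrite mulrCA -expRD (_ : s + (a + b) = a + b + s); last by ring.
  congr ((_ * expR _)%:E); ring.
- by rewrite addr_ge0// ltW.
- exact: (measurable_fun_fubini_tonelli_G (m1 := expo2 a0 b0) (fun q => (\1_A q)%:E)).
- move=> t t0 te; rewrite integral0_eq// => p _.
  by rewrite indicE memNset// => -[/= /(lt_le_trans te)]; rewrite ltxx.
move=> t et.
pose B := `]t - r, +oo[%classic `*` `]t - (r + e), +oo[%classic : set (RT * RT).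
have -> : (fun p => (\1_A (p, t))%:E) = (fun p => (\1_B p)%:E) :> (RT * RT -> \bar R).
  apply/funext => p; rewrite !indicE.
  suff -> : ((p, t) \in A) = (p \in B) by [].
  apply/idP/idP; rewrite !inE /A /B /=.
    by move=> [_ h1 h2]; rewrite !in_itv/= !andbT !ltrBlDl.
  by rewrite !in_itv/= !andbT !ltrBlDl => -[h1 h2]; split=> //; exact: ltW.
rewrite integral_indic ?setIT//; last exact: measurableX.
transitivity (expo a0 `](t - r)%R, +oo[%classic * expo b0 `](t - (r + e))%R, +oo[%classic)%E.
  exact: product_measure1E.
rewrite !expo_gt//; last 2 first.
- by rewrite subr_ge0 ltW.
- by rewrite subr_ge0 ltW// (le_lt_trans _ et)// lerDl.
rewrite -EFinM -!expRD; congr (expR _)%:E; ring.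
Qed.

End exponential_clocks.

(** * Integrals over a single epoch *)

Section epochs.
Context {R : realType} {m : nat} {par : map_param R m}
  {d : measure_display} {Omega : measurableType d}
  {P : 'I_m -> probability Omega R} (Z : map_process par P).
Variables (k : 'I_m) (n l : nat) (j : 'I_m).
Local Notation RT := (measurableTypeR R).
Local Notation W := (fun w => ((stay_start Z n w, jump_clock Z n l w), level Z n l w)).

Lemma past_state :
  measurable_fun setT (W : pastT Z n l -> RT * RT * RT).
Proof.
apply/measurable_fun_pair; first apply/measurable_fun_pair.
- exact: past_stay_start.
- by apply: past_jump_clock; rewrite eqxx leqnn orbT.
- by apply: past_level; rewrite eqxx leqnn orbT.
Qed.

Lemma measurable_state : measurable_fun setT W.
Proof. exact (measurableT_comp past_state (@measurable_past_id _ _ _ _ _ _ Z n l)). Qed.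

Lemma measurable_level : measurable_fun setT (level Z n l).
Proof. exact (measurableT_comp measurable_snd measurable_state). Qed.

Definition clocks : probability (RT * RT)%type R :=
  expo2 (nu_gt0 par j) (lam_gt0 par j).

Definition marked_clocks (law : probability RT R) :
  probability ((RT * RT) * RT)%type R := (clocks \x law)%E.

(* e^{-nu_j clock} is the probability that the stay outlasts the first l jumps:
   the event [alive n l] depends on zeta n, hence not only on the past. *)
Definition weight (s : R) w : R :=
  expR (- (s * epoch_start Z n l w) - nu par j * jump_clock Z n l w).

Lemma measurable_weight s : measurable_fun setT (weight s).
Proof.
have mS := measurableT_comp (measurableT_comp measurable_fst measurable_fst) measurable_state.
have mE := measurableT_comp (measurableT_comp measurable_snd measurable_fst) measurable_state.
apply: (measurableT_comp (@measurable_expR R)); apply: measurable_funB.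
  apply: (measurableT_comp (@oppr_measurable R setT)).
  by apply: measurable_funM => //; apply: measurable_funD.
exact: measurable_funM.
Qed.

Lemma measurable_shift_prob (law : probability RT R) (J : set RT) : measurable J ->
  measurable_fun setT (fun y : RT => law [set q | J (y + q)]).
Proof.
move=> mJ.
have mJ2 : measurable [set z : RT * RT | J (z.1 + z.2)].
  rewrite -[X in measurable X]setTI.
  have mm : measurable_fun setT (fun z : RT * RT => z.1 + z.2).
    exact: measurable_funD.
  exact: (mm measurableT _ mJ).
rewrite (_ : (fun _ => _) = law \o xsection [set z : RT * RT | J (z.1 + z.2)]).
  exact: measurable_fun_xsection.
apply/funext => y /=; congr (law _); apply/seteqP.
by split=> q; rewrite /xsection/= inE.
Qed.

Section marks.
Variables (r : 'I_m) (mark : Omega -> RT) (law : probability RT R) (D : set Omega)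
  (c : {nonneg R}).
Hypotheses (mmark : measurable_fun setT mark) (mD : measurable D).
Hypothesis D_indep : forall (A : set (pastT Z n l)) (Cz Ce Cm : set RT),
  measurable A -> measurable Cz -> measurable Ce -> measurable Cm ->
  P k (A `&` [set w | emb Z n w = j] `&` D `&`
       [set w | [/\ Cz (zeta Z n w), Ce (Defs.eta Z n l w) & Cm (mark w)]]) =
  (c%:num%:E * P k (A `&` [set w | emb Z n w = j]) *
   (expo (nu_gt0 par j) Cz * expo (lam_gt0 par j) Ce * law Cm))%E.

(** The mark is abstract in order to serve both ways an epoch can end: [kappa n l] with D full and c
    = 1, or [chi n] with D the event that the next state is r and c = p_{jr}. *)
Lemma integral_mark_indep (A : set (pastT Z n l)) (f : (RT * RT * RT) * (RT * RT * RT) -> \bar R) :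
  measurable A -> measurable_fun setT f -> (forall z, 0 <= f z)%E ->
  (\int[P k]_(w in A `&` [set w | emb Z n w = j] `&` D)
     f (W w, ((zeta Z n w, Defs.eta Z n l w), mark w)) =
   c%:num%:E * \int[P k]_(w in A `&` [set w | emb Z n w = j])
     \int[marked_clocks law]_p f (W w, p))%E.
Proof.
move=> mA mf f0.
have mE : measurable [set w | emb Z n w = j] by exact: measurable_emb.
have mA' : d.-measurable (A : set Omega) by exact: past_sub mA.
have mAE : d.-measurable ((A : set Omega) `&` [set w | emb Z n w = j]) by exact: measurableI.
have mAED : d.-measurable ((A : set Omega) `&` [set w | emb Z n w = j] `&` D).
  exact: measurableI.
have mWp := past_state; have mW := measurable_state.
have mX : measurable_fun setT (fun w => (zeta Z n w, Defs.eta Z n l w) : RT * RT).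
  by apply/measurable_fun_pair; [exact: measurable_zeta|exact: measurable_eta].
have mXm : measurable_fun setT (fun w => ((zeta Z n w, Defs.eta Z n l w), mark w)).
  exact/measurable_fun_pair.
have mF : measurable_fun setT (fun v => \int[marked_clocks law]_p f (v, p))%E.
  exact: (measurable_fun_fubini_tonelli_F (m2 := marked_clocks law) f mf f0).
have mFW : measurable_fun setT (fun w => \int[marked_clocks law]_p f (W w, p))%E.
  exact (measurableT_comp mF mW).
rewrite -(ge0_integral_mrestr (P k) mAED (f := fun w =>
  f (W w, ((zeta Z n w, Defs.eta Z n l w), mark w))))//; last first.
  by apply: (measurableT_comp mf); exact/measurable_fun_pair.
rewrite -(ge0_integral_mrestr (P k) mAE (f := fun w =>
  \int[marked_clocks law]_p f (W w, p))%E)//; last first.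
  by move=> w; exact: integral_ge0.
apply: (integral_indep (rho := marked_clocks law) mW mXm) => // B C mB mC.
rewrite /= /mrestr.
have mB' : measurable (W @^-1` B : set (pastT Z n l)).
  by rewrite -[X in measurable X]setTI; exact: mWp.
have mAB : measurable (A `&` W @^-1` B : set (pastT Z n l)) by exact: measurableI.
have mM Cm : measurable Cm -> measurable (mark @^-1` Cm).
  by move=> mCm; rewrite -[X in measurable X]setTI; exact: mmark.
pose AB := A `&` W @^-1` B.
have mABED : d.-measurable (AB `&` [set w | emb Z n w = j] `&` D).
  by apply: measurableI => //; apply: measurableI => //; exact: past_sub mAB.
have -> : W @^-1` B `&` (fun w => ((zeta Z n w, Defs.eta Z n l w), mark w)) @^-1` C `&`
    (A `&` [set w | emb Z n w = j] `&` D) =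
    [set w | C ((zeta Z n w, Defs.eta Z n l w), mark w)] `&`
    (AB `&` [set w | emb Z n w = j] `&` D).
  apply/seteqP; split=> w.
    by move=> [[wB wC] [[wA we] wD]]; do 4 ?split.
  by move=> [wC [[[wA wB] we] wD]]; do 4 ?split.
rewrite (_ : W @^-1` B `&` (A `&` [set w | emb Z n w = j]) =
    AB `&` [set w | emb Z n w = j]); last by rewrite setIA (setIC _ A).
(* The triple is taken apart one variable at a time: the mark here, the two clocks from each other
   below. *)
apply: (pair_indep (mu := mrestr (P k) mABED) (rho1 := clocks) mX mmark) => // C12 Cm mC12 mCm.
have mABEDm : d.-measurable (mark @^-1` Cm `&` (AB `&` [set w | emb Z n w = j] `&` D)).
  by apply: measurableI => //; exact: mM.
rewrite -muleA (muleC (clocks _)) muleA.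
transitivity (mrestr (P k) mABEDm [set w | C12 (zeta Z n w, Defs.eta Z n l w)]).
  rewrite /= /mrestr /=.
  by rewrite setIA.
apply: (pair_indep (rho1 := expo (nu_gt0 par j)) (rho2 := expo (lam_gt0 par j))
  (measurable_zeta Z n) (measurable_eta Z n l)) => // Cz Ce mCz mCe.
rewrite /= /mrestr.
transitivity (P k (AB `&` [set w | emb Z n w = j] `&` D `&`
  [set w | [/\ Cz (zeta Z n w), Ce (Defs.eta Z n l w) & Cm (mark w)]])).
  congr (P k _); apply/seteqP; split=> w.
    by move=> [[wz we] [wm wABED]]; split.
  by move=> [wABED [wz we wm]]; do 2 ?split.
rewrite D_indep// -!muleA; congr (_ * (_ * _))%E.
by rewrite muleA muleC.
Qed.

(** The condition [J] concerns the mark alone, so the clocks integrate out separately. The last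
    hypothesis is the common shape of the clock integrals; K is lambda_j or nu_j divided by nu_j +
    lambda_j + s. *)
Lemma integral_mark (s K : R) (A : set (pastT Z n l)) (J : set RT)
    (g : (RT * RT) * (RT * RT) -> R) :
  measurable A -> measurable J -> measurable_fun setT g -> (forall z, 0 <= g z) ->
  0 <= K ->
  (forall r e : R, 0 <= e -> (\int[clocks]_p (g ((r, e), p))%:E =
     (K * expR (- (s * (r + e)) - nu par j * e))%:E)%E) ->
  (\int[P k]_(w in A `&` [set w | emb Z n w = j] `&` D `&`
       [set w | J (level Z n l w + mark w)%R])
     (g ((stay_start Z n w, jump_clock Z n l w), (zeta Z n w, Defs.eta Z n l w)))%:E =
   (c%:num * K)%:E * \int[P k]_(w in A `&` [set w | emb Z n w = j])
     ((weight s w)%:E * law [set q | J (level Z n l w + q)%R]))%E.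
Proof.
move=> mA mJ mg g0 K0 gK.
have mJ2 : measurable [set z : (RT * RT * RT) * (RT * RT * RT) | J (z.1.2 + z.2.2)].
  rewrite -[X in measurable X]setTI.
  have mm : measurable_fun setT (fun z : (RT * RT * RT) * (RT * RT * RT) => z.1.2 + z.2.2).
    apply: measurable_funD.
      exact: (measurableT_comp measurable_snd measurable_fst).
    exact: (measurableT_comp measurable_snd measurable_snd).
  exact: (mm measurableT _ mJ).
pose f (z : (RT * RT * RT) * (RT * RT * RT)) : \bar R :=
  (g (z.1.1, z.2.1) * \1_[set z | J (z.1.2 + z.2.2)] z)%:E.
have mf : measurable_fun setT f.
  apply/measurable_EFinP; apply: measurable_funM => //.
  apply: (measurableT_comp mg); apply/measurable_fun_pair.
    exact: (measurableT_comp measurable_fst measurable_fst).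
  exact: (measurableT_comp measurable_fst measurable_snd).
have f0 z : (0 <= f z)%E by rewrite lee_fin mulr_ge0.
have fE := integral_mark_indep mA mf f0.
rewrite [LHS]integral_mkcondr.
transitivity (\int[P k]_(w in A `&` [set w | emb Z n w = j] `&` D)
     f (W w, ((zeta Z n w, Defs.eta Z n l w), mark w)))%E.
  apply: eq_integral => w _; rewrite /f /patch indicE.
  have [Jw|nJ] := pselect (J (level Z n l w + mark w)).
    by rewrite !mem_set//= mulr1.
  by rewrite !memNset//= mulr0.
have mlaw : measurable_fun setT (fun w => law [set q | J (level Z n l w + q)]).
  exact (measurableT_comp (measurable_shift_prob law mJ) measurable_level).
rewrite fE EFinM -muleA; congr (_ * _)%E.
have mAE : d.-measurable (A `&` [set w | emb Z n w = j] : set Omega).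
  by apply: measurableI; [exact: past_sub mA|exact: measurable_emb].
rewrite -ge0_integralZl_EFin//; last 2 first.
- by move=> w _; rewrite mule_ge0// lee_fin expR_ge0.
- apply: measurable_funTS; apply: emeasurable_funM => //.
  by apply/measurable_EFinP; exact: measurable_weight.
apply: eq_integral => w _; set e := jump_clock Z n l w.
pose B := [set q : RT | J (level Z n l w + q)].
have mB : measurable B.
  rewrite (_ : B = xsection [set z : RT * RT | J (z.1 + z.2)] (level Z n l w)).
    apply: measurable_xsection; rewrite -[X in measurable X]setTI.
    have mm : measurable_fun setT (fun z : RT * RT => z.1 + z.2).
      exact: measurable_funD.
    exact: (mm measurableT _ mJ).
  by apply/seteqP; split=> q; rewrite /xsection/= inE.
transitivity (\int[clocks \x law]_p
    ((g ((stay_start Z n w, e), p.1))%:E * (\1_B p.2)%:E))%E.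
  apply: eq_integral => p _; rewrite /f -EFinM !indicE.
  suff -> : ((W w, p) \in [set z : (RT * RT * RT) * (RT * RT * RT) | J (z.1.2 + z.2.2)]) =
      (p.2 \in B) by [].
  by apply/idP/idP; rewrite !inE.
rewrite (@integral_prod_indic _ _ _ _ _ clocks law
   (fun p => (g ((stay_start Z n w, e), p))%:E) B)//; last 2 first.
- by apply/measurable_EFinP; exact: (measurableT_comp mg (measurable_pair1 _)).
- by move=> p; rewrite lee_fin.
rewrite gK ?jump_clock_ge0//.
by rewrite EFinM -!muleA.
Qed.

End marks.

Definition inside_at (T x : R) : set Omega :=
  [set w | inside Z T x n l w] `&` [set w | emb Z n w = j].

Variables (T x s : R) (J : set RT).
Hypotheses (s0 : 0 < s) (mJ : measurable J).

Let nu0 := nu_gt0 par j.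
Let lam0 := lam_gt0 par j.
Let total0 : 0 < nu par j + lam par j + s.
Proof. by rewrite !addr_gt0. Qed.

(** A jump of xi inside a stay is indifferent to the next state, which is summed out; the
    probabilities p_{jr} add up to the factor 1. *)
Lemma kappa_indep (A : set (pastT Z n l)) (Cz Ce Cm : set RT) :
  measurable A -> measurable Cz -> measurable Ce -> measurable Cm ->
  P k (A `&` [set w | emb Z n w = j] `&` setT `&`
       [set w | [/\ Cz (zeta Z n w), Ce (Defs.eta Z n l w) & Cm (kappa Z n l w)]]) =
  ((1%:nng : {nonneg R})%:num%:E * P k (A `&` [set w | emb Z n w = j]) *
   (expo (nu_gt0 par j) Cz * expo (lam_gt0 par j) Ce * jump_law par j Cm))%E.
Proof.
move=> mA mz me mm; rewrite setIT mul1e.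
rewrite (measure_ord_partition (P k) (measurable_emb Z n.+1)); last first.
  apply: measurableI.
    by apply: measurableI; [exact: past_sub mA|exact: measurable_emb].
  rewrite (_ : [set w | _] = \bigcup_(r in [set: 'I_m]) future Z n l r Cz Ce Cm setT).
    by apply: fin_bigcup_measurable => // r _; exact: measurable_future.
  apply/seteqP; split=> w /=; first by move=> [? ? ?]; exists (emb Z n.+1 w).
  by move=> [r _ []].
rewrite (eq_bigr (fun r => P k (A `&` [set w | emb Z n w = j]) *
   (expo (nu_gt0 par j) Cz * expo (lam_gt0 par j) Ce * jump_law par j Cm) *
   (ptrans par j r)%:E)%E); last first.
  move=> r _; rewrite (_ : _ `&` [set w | emb Z n.+1 w = r] = A `&` [set w | emb Z n w = j] `&`
     future Z n l r Cz Ce Cm setT).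
    etransitivity; first exact (future_indep k j r mz me mm measurableT mA).
    by rewrite probability_setT mule1 -!muleA.
  apply/seteqP; split=> w.
    by move=> [[wA [w1 w2 w3]] w4]; split.
  by move=> [wA [w4 w1 w2 w3 _]]; split.
rewrite -ge0_sume_distrr; last by move=> r _; rewrite lee_fin ptrans_ge0.
by rewrite sumEFin ptrans_sum1 mule1.
Qed.

Lemma integral_epoch_jump :
  (\int[P k]_(w in inside_at T x `&`
       [set w | alive Z n l.+1 w /\ J (level Z n l w + kappa Z n l w)%R])
     (expR (- (s * epoch_start Z n l.+1 w)))%:E =
   (lam par j / (nu par j + lam par j + s))%:E * \int[P k]_(w in inside_at T x)
     ((weight s w)%:E * jump_law par j [set q | J (level Z n l w + q)%R]))%E.
Proof.
(* The first pair holds the start of the stay and the jump clock, the second the sojourn and waiting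
   times. The inequality is [alive n l.+1], and the exponent contains the time of the jump. *)
pose g (z : (RT * RT) * (RT * RT)) :=
  \1_[set z : (RT * RT) * (RT * RT) | z.1.2 + z.2.2 < z.2.1] z *
  expR (- (s * (z.1.1 + z.1.2 + z.2.2))).
have m12 : measurable_fun setT (fun z : (RT * RT) * (RT * RT) => z.1.2).
  exact: (measurableT_comp measurable_snd measurable_fst).
have m11 : measurable_fun setT (fun z : (RT * RT) * (RT * RT) => z.1.1).
  exact: (measurableT_comp measurable_fst measurable_fst).
have m22 : measurable_fun setT (fun z : (RT * RT) * (RT * RT) => z.2.2).
  exact: (measurableT_comp measurable_snd measurable_snd).
have m21 : measurable_fun setT (fun z : (RT * RT) * (RT * RT) => z.2.1).
  exact: (measurableT_comp measurable_fst measurable_snd).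
have mg : measurable_fun setT g.
  apply: measurable_funM.
    apply: measurable_indic; apply: measurable_lt_set => //.
    exact: measurable_funD.
  apply: (measurableT_comp (@measurable_expR R)).
  apply: (measurableT_comp (@oppr_measurable R setT)).
  apply: measurable_funM => //; apply: measurable_funD => //.
  exact: measurable_funD.
have g0 z : 0 <= g z by rewrite mulr_ge0 ?expR_ge0.
have K0 : 0 <= lam par j / (nu par j + lam par j + s).
  by rewrite divr_ge0// ltW.
have := integral_mark (measurable_kappa Z n l) measurableT kappa_indep
  (@past_inside _ _ _ _ _ _ Z n l T x) mJ mg g0 K0.
rewrite setIT mul1r => <-.
  rewrite (_ : [set w | alive _ _ _ _ /\ _] = [set w | J (level Z n l w + kappa Z n l w)] `&`
    [set w | alive Z n l.+1 w]); last by apply/seteqP; split=> w [].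
  rewrite setIA [LHS]integral_mkcondr; apply: eq_integral => w _.
  rewrite /patch /g indicE /=.
  have [al|nal] := boolP (alive Z n l.+1 w).
    rewrite !mem_set//= ?mul1r; last by rewrite -jump_clockS.
    by rewrite /epoch_start jump_clockS addrA.
  by rewrite !memNset/= ?mul0r//; apply/negP; rewrite -?jump_clockS.
move=> a e e0; rewrite -(integral_jump_first a (nu_gt0 par j) (lam_gt0 par j) s0 e0).
apply: (@eq_integral _ _ _ clocks setT) => p _; rewrite /g !indicE.
suff -> : ((a, e, p) \in [set z : (RT * RT) * (RT * RT) | z.1.2 + z.2.2 < z.2.1]) =
    (p \in [set p : RT * RT | e + p.2 < p.1]) by [].
by apply/idP/idP; rewrite !inE.
Qed.

Lemma integral_epoch_trans (r : 'I_m) :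
  (\int[P k]_(w in inside_at T x `&` [set w | emb Z n.+1 w = r] `&`
       [set w | [/\ alive Z n l w, ~~ alive Z n l.+1 w &
                    J (level Z n l w + chi Z n w)%R]])
     (expR (- (s * stay_start Z n.+1 w)))%:E =
   (ptrans par j r * (nu par j / (nu par j + lam par j + s)))%:E *
     \int[P k]_(w in inside_at T x)
     ((weight s w)%:E * trans_law par j r [set q | J (level Z n l w + q)%R]))%E.
Proof.
pose g (z : (RT * RT) * (RT * RT)) :=
  \1_[set z : (RT * RT) * (RT * RT) | z.1.2 < z.2.1 /\ z.2.1 <= z.1.2 + z.2.2] z *
  expR (- (s * (z.1.1 + z.2.1))).
have m12 : measurable_fun setT (fun z : (RT * RT) * (RT * RT) => z.1.2).
  exact: (measurableT_comp measurable_snd measurable_fst).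
have m11 : measurable_fun setT (fun z : (RT * RT) * (RT * RT) => z.1.1).
  exact: (measurableT_comp measurable_fst measurable_fst).
have m22 : measurable_fun setT (fun z : (RT * RT) * (RT * RT) => z.2.2).
  exact: (measurableT_comp measurable_snd measurable_snd).
have m21 : measurable_fun setT (fun z : (RT * RT) * (RT * RT) => z.2.1).
  exact: (measurableT_comp measurable_fst measurable_snd).
have mg : measurable_fun setT g.
  apply: measurable_funM.
    apply: measurable_indic.
    apply: (@measurableI _ _ [set z : (RT * RT) * (RT * RT) | z.1.2 < z.2.1]
      [set z | z.2.1 <= z.1.2 + z.2.2]); first exact: measurable_lt_set.
    by apply: measurable_le_set => //; exact: measurable_funD.
  apply: (measurableT_comp (@measurable_expR R)).
  apply: (measurableT_comp (@oppr_measurable R setT)).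
  by apply: measurable_funM => //; apply: measurable_funD.
have g0 z : 0 <= g z by rewrite mulr_ge0 ?expR_ge0.
have K0 : 0 <= nu par j / (nu par j + lam par j + s).
  by rewrite divr_ge0// ltW.
have indep (A : set (pastT Z n l)) (Cz Ce Cm : set RT) :
  measurable A -> measurable Cz -> measurable Ce -> measurable Cm ->
  P k (A `&` [set w | emb Z n w = j] `&` [set w | emb Z n.+1 w = r] `&`
       [set w | [/\ Cz (zeta Z n w), Ce (Defs.eta Z n l w) & Cm (chi Z n w)]]) =
  ((NngNum (ptrans_ge0 par j r))%:num%:E * P k (A `&` [set w | emb Z n w = j]) *
   (expo (nu_gt0 par j) Cz * expo (lam_gt0 par j) Ce * trans_law par j r Cm))%E.
  move=> mA mz me mm /=.
  rewrite (_ : _ `&` [set w | and3 _ _ _] = A `&` [set w | emb Z n w = j] `&`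
       future Z n l r Cz Ce setT Cm).
    etransitivity; first exact (future_indep k j r mz me measurableT mm mA).
    rewrite probability_setT mule1.
    set X := P k _; rewrite [in RHS](muleC _ X) -!muleA; congr (_ * _)%E.
    by rewrite [RHS]muleCA; congr (_ * _)%E; rewrite [RHS]muleCA.
  apply/seteqP; split=> w.
    by move=> [[wA w4] [w1 w2 w3]]; split.
  by move=> [wA [w4 w1 w2 _ w3]]; split; [split|].
have := integral_mark (measurable_chi Z n) (measurable_emb Z n.+1 r) indep
  (@past_inside _ _ _ _ _ _ Z n l T x) mJ mg g0 K0.
move=> /= <-.
  rewrite (_ : [set w | and3 _ _ _] = [set w | J (level Z n l w + chi Z n w)] `&`
    [set w | alive Z n l w /\ ~~ alive Z n l.+1 w]); last first.
    by apply/seteqP; split=> w; [case|move=> [? []]].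
  rewrite setIA [LHS]integral_mkcondr; apply: eq_integral => w _.
  rewrite /patch /g indicE /=.
  have [[al nal]|nal] := pselect (alive Z n l w /\ ~~ alive Z n l.+1 w).
    rewrite !mem_set//= ?mul1r; first by rewrite stay_startS.
    by split=> //; rewrite -jump_clockS leNgt.
  rewrite !memNset/= ?mul0r// => -[h1 h2]; apply: nal; split=> //.
  by rewrite /alive -leNgt jump_clockS.
move=> a e e0; rewrite -(integral_stay_first a (nu_gt0 par j) (lam_gt0 par j) s0 e0).
apply: (@eq_integral _ _ _ clocks setT) => p _; rewrite /g !indicE.
suff -> : ((a, e, p) \in [set z : (RT * RT) * (RT * RT) |
      z.1.2 < z.2.1 /\ z.2.1 <= z.1.2 + z.2.2]) =
    (p \in [set p : RT * RT | e < p.1 /\ p.1 <= e + p.2]) by [].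
by apply/idP/idP; rewrite !inE.
Qed.

(** Membership of a time in the epoch, as a condition on the state of the past, the two clocks and
    the time. Epochs are sections of this measurable set, whence the measurability of their
    masses. *)
Let clock_window := [set q : ((RT * RT * RT) * (RT * RT)) * RT |
  [/\ q.1.1.1.1 + q.1.1.1.2 <= q.2, q.2 < q.1.1.1.1 + q.1.2.1 &
      q.2 < q.1.1.1.1 + q.1.1.1.2 + q.1.2.2]].

Let measurable_window : measurable clock_window.
Proof.
have m111 : measurable_fun setT
    (fun q : ((RT * RT * RT) * (RT * RT)) * RT => q.1.1.1.1).
  apply: (measurableT_comp measurable_fst); apply: (measurableT_comp measurable_fst).
  exact: (measurableT_comp measurable_fst measurable_fst).
have m112 : measurable_fun setT
    (fun q : ((RT * RT * RT) * (RT * RT)) * RT => q.1.1.1.2).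
  apply: (measurableT_comp measurable_snd); apply: (measurableT_comp measurable_fst).
  exact: (measurableT_comp measurable_fst measurable_fst).
have m121 : measurable_fun setT
    (fun q : ((RT * RT * RT) * (RT * RT)) * RT => q.1.2.1).
  apply: (measurableT_comp measurable_fst).
  exact: (measurableT_comp measurable_snd measurable_fst).
have m122 : measurable_fun setT
    (fun q : ((RT * RT * RT) * (RT * RT)) * RT => q.1.2.2).
  apply: (measurableT_comp measurable_snd).
  exact: (measurableT_comp measurable_snd measurable_fst).
rewrite (_ : clock_window = [set q | q.1.1.1.1 + q.1.1.1.2 <= q.2] `&`
   ([set q | q.2 < q.1.1.1.1 + q.1.2.1] `&`
    [set q | q.2 < q.1.1.1.1 + q.1.1.1.2 + q.1.2.2])); last first.
  by apply/seteqP; split=> q; [case|move=> [? []]].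
apply: measurableI; first by apply: measurable_le_set => //; exact: measurable_funD.
apply: measurableI; apply: measurable_lt_set => //; apply: measurable_funD => //.
exact: measurable_funD.
Qed.

Let epoch_window w : [set t | epoch Z n l w t] =
  xsection clock_window (W w, (zeta Z n w, Defs.eta Z n l w)).
Proof.
apply/seteqP; split=> t; rewrite /xsection/= inE /clock_window /= epochE.
  by move=> /and3P[]; rewrite /epoch_start jump_clockS stay_startS addrA.
by move=> [? ? ?]; rewrite /epoch_start jump_clockS stay_startS addrA; apply/and3P.
Qed.

Lemma measurable_epoch_prob :
  measurable_fun setT (fun w => expo s0 [set t | epoch Z n l w t]).
Proof.
under eq_fun do rewrite epoch_window.
have mX : measurable_fun setT (fun w => (zeta Z n w, Defs.eta Z n l w) : RT * RT).
  by apply/measurable_fun_pair; [exact: measurable_zeta|exact: measurable_eta].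
have mWX : measurable_fun setT (fun w => (W w, (zeta Z n w, Defs.eta Z n l w))).
  by apply/measurable_fun_pair => //; exact: measurable_state.
have := @measurable_fun_xsection _ _ _ _ _ (expo s0) clock_window measurable_window.
move=> h; exact (measurableT_comp h mWX).
Qed.

Lemma integral_epoch_theta (g : RT -> R) : measurable_fun setT g ->
  (forall y, 0 <= g y) ->
  (\int[P k]_(w in inside_at T x)
     ((g (level Z n l w))%:E * expo s0 [set t | epoch Z n l w t]) =
   (s / (nu par j + lam par j + s))%:E * \int[P k]_(w in inside_at T x)
     ((weight s w)%:E * (g (level Z n l w))%:E))%E.
Proof.
move=> mg g0.
pose h (z : (RT * RT * RT) * (RT * RT)) := expo s0 (xsection clock_window z).
have mh : measurable_fun setT h.
  exact: (@measurable_fun_xsection _ _ _ _ _ (expo s0) clock_window measurable_window).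
have h0 z : (0 <= h z)%E by [].
pose f (z : (RT * RT * RT) * (RT * RT * RT)) : \bar R :=
  ((g z.1.2)%:E * h (z.1, z.2.1))%E.
have mf : measurable_fun setT f.
  apply: emeasurable_funM.
    apply/measurable_EFinP; apply: (measurableT_comp mg).
    exact: (measurableT_comp measurable_snd measurable_fst).
  apply: (measurableT_comp mh); apply/measurable_fun_pair => //.
  exact: (measurableT_comp measurable_fst measurable_snd).
have f0 z : (0 <= f z)%E by rewrite mule_ge0// lee_fin.
(* The jump size is taken as the mark here, and is integrated out below with total mass 1. *)
have := integral_mark_indep (measurable_kappa Z n l) measurableT kappa_indep
  (@past_inside _ _ _ _ _ _ Z n l T x) mf f0.
rewrite setIT mul1e => fE.
transitivity (\int[P k]_(w in inside_at T x)
    f (W w, ((zeta Z n w, Defs.eta Z n l w), kappa Z n l w)))%E.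
  by apply: eq_integral => w _; rewrite /f /h epoch_window.
rewrite fE -ge0_integralZl_EFin//; last 4 first.
- apply: measurableI; last exact: measurable_emb.
  exact: past_sub (@past_inside _ _ _ _ _ _ Z n l T x).
- by move=> w _; rewrite mule_ge0// lee_fin ?expR_ge0.
- apply: measurable_funTS; apply: emeasurable_funM; apply/measurable_EFinP.
    exact: measurable_weight.
  exact: (measurableT_comp mg measurable_level).
- by rewrite divr_ge0// ltW.
apply: eq_integral => w _.
pose v := W w.
transitivity ((g (level Z n l w))%:E * \int[clocks]_p h (v, p))%E.
  have mhv : measurable_fun setT (fun p => h (v, p)).
    exact: (measurableT_comp mh (measurable_pair1 _)).
  have := @integral_prod_indic _ _ _ _ _ clocks (jump_law par j)
    (fun p => ((g (level Z n l w))%:E * h (v, p))%E) setT.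
  rewrite probability_setT mule1 => E1.
  transitivity (\int[clocks \x jump_law par j]_p
     ((g (level Z n l w))%:E * h (v, p.1) * (\1_[set: RT] p.2)%:E))%E.
    by apply: eq_integral => p _; rewrite indicT mule1.
  rewrite E1//; last 2 first.
  - by apply: emeasurable_funM.
  - by move=> p; rewrite mule_ge0// lee_fin.
  by rewrite ge0_integralZl_EFin.
rewrite [RHS]muleA [RHS]muleC; congr (_ * _)%E.
rewrite -EFinM -(integral_epoch_length nu0 lam0 s0); last 2 first.
- exact: stay_start_ge0.
- exact: jump_clock_ge0.
apply: eq_integral => p _; rewrite /h; congr (expo s0 _).
by apply/seteqP; split=> t; rewrite /xsection/= inE.
Qed.

End epochs.

(** * Approximation of times from the right *)

Section grid.
Context {R : realType}.
Implicit Types t e : R.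

(** With a = [grid_floor b t], [grid_next a b] is the first multiple of 1 / (b + 1) strictly after
    t. Approximation from the right is what right-constant paths call for. *)
Definition grid_floor (b : nat) t : nat := Num.truncn (t * b.+1%:R).
Definition grid_next (a b : nat) : R := a.+1%:R / b.+1%:R.

Lemma grid_next_gt b t : 0 <= t -> t < grid_next (grid_floor b t) b.
Proof. by move=> t0; rewrite ltr_pdivlMr// truncnS_gt. Qed.

Lemma grid_next_lt t e : 0 <= t -> 0 < e -> exists b0, forall b, (b0 <= b)%N ->
  grid_next (grid_floor b t) b < t + e.
Proof.
move=> t0 e0; exists (Num.truncn (e^-1)) => b b0b.
have b1 : 0 < b.+1%:R :> R by [].
rewrite ltr_pdivrMr// mulrDl -natr1.
have h1 : (grid_floor b t)%:R <= t * b.+1%:R by rewrite truncn_le// mulr_ge0.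
have h2 : 1 < e * b.+1%:R.
  rewrite mulrC -ltr_pdivrMr// div1r (lt_le_trans (truncnS_gt _))//.
  by rewrite ler_nat.
exact: ler_ltD.
Qed.

Lemma measurable_grid_cell (a b : nat) :
  measurable [set t : measurableTypeR R | 0 <= t /\ grid_floor b t = a].
Proof.
rewrite (_ : [set t | _] = [set t : measurableTypeR R | a%:R <= t * b.+1%:R] `&`
    [set t : measurableTypeR R | t * b.+1%:R < a.+1%:R]).
  apply: measurableI; first by apply: measurable_le_set => //; exact: measurable_funM.
  by apply: measurable_lt_set => //; exact: measurable_funM.
apply/seteqP; split=> t /=.
  move=> [t0 <-]; split; first by rewrite truncn_le// mulr_ge0.
  exact: truncnS_gt.
move=> [h1 h2]; have t0 : 0 <= t by rewrite -(pmulr_lge0 _ (ltr0Sn R b)) (le_trans _ h1).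
by split=> //; apply/eqP; rewrite truncn_eq ?h1 ?h2// mulr_ge0.
Qed.

End grid.

(** * Joint measurability in path and time, and integration over theta *)

Section random_time.
Context {R : realType} {m : nat} {par : map_param R m}
  {d : measure_display} {Omega : measurableType d}
  {P : 'I_m -> probability Omega R} (Z : map_process par P).
Variables (T x : R).
Local Notation RT := (measurableTypeR R).
Local Notation I := (`]x - T, x[%classic : set R).
Hypothesis I0 : I 0.

Definition gensZ : set (set Omega) :=
  [set A | exists2 t, 0 <= t &
     (exists2 B : set RT, measurable B & A = xi Z t @^-1` B) \/
     (exists j, A = [set w | st Z t w = j])].
(* theta is only known to be independent of this sub-sigma-algebra, so that joint
   measurability in (path, time) has to be proved over it: the first exit is
   detected, and xi and x are approximated, along rational times. *)
Definition OmegaZ := g_sigma_algebraType gensZ.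

Lemma measurable_gensZ A : gensZ A -> measurable A.
Proof.
move=> [t t0 [[B mB ->]|[j ->]]].
  by rewrite -[X in measurable X]setTI; exact: (measurable_xi Z t0).
exact: measurable_st.
Qed.

Lemma sigmaZ_sub (A : set OmegaZ) : measurable A -> d.-measurable (A : set Omega).
Proof.
apply: smallest_sub; first exact: sigma_algebra_measurable.
exact: measurable_gensZ.
Qed.

Lemma measurable_idZ : measurable_fun setT (id : Omega -> OmegaZ).
Proof. by move=> _ A mA; rewrite setTI; exact: sigmaZ_sub mA. Qed.

Lemma sigmaZ_xi t (B : set RT) : 0 <= t -> measurable B ->
  measurable (xi Z t @^-1` B : set OmegaZ).
Proof. by move=> t0 mB; apply: sub_sigma_algebra; exists t => //; left; exists B. Qed.

Lemma sigmaZ_st t j : 0 <= t -> measurable ([set w | st Z t w = j] : set OmegaZ).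
Proof. by move=> t0; apply: sub_sigma_algebra; exists t => //; right; exists j. Qed.

(** The level, the state and the comparison with the exit time are all constant along an epoch, so
    one e serves for the three. *)
Lemma right_constant w t : 0 <= t -> exists2 e, 0 < e & forall u, t <= u < t + e ->
  [/\ xi Z u w = xi Z t w, st Z u w = st Z t w &
      (u%:E < tau Z x T w)%E <-> (t%:E < tau Z x T w)%E].
Proof.
move=> t0; have [n [l ent]] := epoch_ex Z w t0.
have /andP[h1 h2] := ent.
exists (epoch_end Z n l w - t); first by rewrite subr_gt0.
move=> u /andP[tu ut]; have enu : epoch Z n l w u.
  by rewrite /epoch (le_trans h1)//=; move: ut; rewrite addrC subrK.
split.
- by rewrite (xi_epoch ent) (xi_epoch enu).
- by rewrite (st_epoch ent) (st_epoch enu).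
- by rewrite (lt_tauP I0 ent) (lt_tauP I0 enu).
Qed.

(** An exit at a time u < q persists for a while to the right of u and is seen at some grid point
    before q. Right-constancy at q excludes an exit shortly after q, which makes the inequality
    strict. *)
Lemma lt_tau_gridP w q : 0 < q -> (q%:E < tau Z x T w)%E <->
  I (xi Z q w) /\ forall a b, grid_next a b < q -> I (xi Z (grid_next a b) w).
Proof.
move=> q0; split=> [qt|[Iq Ig]].
  split=> [|a b abq]; first by apply: (tau_xi I0) qt; exact: ltW.
  apply: (tau_xi I0); first by rewrite divr_ge0.
  by apply: lt_trans qt; rewrite lte_fin.
have [e e0 qe] := right_constant w (ltW q0).
apply: (@lt_le_trans _ _ (q + e)%:E); first by rewrite lte_fin ltrDl.
apply: le_ereal_inf_tmp => _ [u [u0 nIu] <-].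
rewrite lee_fin leNgt; apply/negP => uqe; apply: nIu.
have [qu|uq] := leP q u.
  by have [|-> _ _] := qe u; first by rewrite qu uqe.
have [e' e'0 ue'] := right_constant w (ltW u0).
(* Within this distance a grid point after u still sees the value at u and still precedes q. *)
have e1 : 0 < Num.min e' (q - u) by rewrite lt_min e'0 subr_gt0.
have [b /(_ b (leqnn b)) gb] := grid_next_lt (ltW u0) e1.
have gt := grid_next_gt b (ltW u0).
have [|<- _ _] := ue' (grid_next (grid_floor b u) b).
  rewrite ltW//=; apply: lt_le_trans gb _.
  by rewrite lerD2l ge_min lexx.
apply: Ig; apply: lt_le_trans gb _.
by rewrite -lerBrDl ge_min lexx orbT.
Qed.

Lemma sigmaZ_lt_tau q : 0 < q ->
  measurable ([set w | (q%:E < tau Z x T w)%E] : set OmegaZ).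
Proof.
move=> q0; rewrite (_ : [set w | _] = (xi Z q @^-1` I) `&` \bigcap_a \bigcap_b
    (if grid_next a b < q then xi Z (grid_next a b) @^-1` I else setT)).
  apply: measurableI; first by apply: sigmaZ_xi => //; exact: ltW.
  apply: bigcapT_measurable => a; apply: bigcapT_measurable => b; case: ifP => // _.
  by apply: sigmaZ_xi => //; rewrite divr_ge0.
apply/seteqP; split=> w /=.
  move=> /(lt_tau_gridP w q0)[Iq Ig]; split=> // a _ b _; case: ifPn => //; exact: Ig.
move=> [Iq Ig]; apply/(lt_tau_gridP w q0); split=> // a b ab.
by have := Ig a Logic.I b Logic.I; rewrite ab.
Qed.

Definition before_exit (j : 'I_m) (B : set RT) : set (OmegaZ * RT) :=
  [set p | [/\ 0 <= p.2, st Z p.2 p.1 = j, (p.2%:E < tau Z x T p.1)%E &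
               B (xi Z p.2 p.1)]].

(** By right-constancy, a pair (w, t) belongs to the set exactly when, for all fine enough meshes, w
    satisfies the conditions at the grid point following t. For each mesh this is a countable union
    of rectangles. *)
Lemma measurable_before_exit j (B : set RT) : measurable B ->
  measurable (before_exit j B).
Proof.
move=> mB.
pose slice (q : R) : set OmegaZ := [set w | st Z q w = j] `&`
  ([set w | (q%:E < tau Z x T w)%E] `&` (xi Z q @^-1` B)).
have -> : before_exit j B = \bigcup_b0 \bigcap_b (if (b0 <= b)%N then
   \bigcup_a (slice (grid_next a b) `*` [set t : RT | 0 <= t /\ grid_floor b t = a])
   else setT).
  apply/seteqP; split=> -[w t].
    move=> [/= t0 stj tt Bt]; have [e e0 te] := right_constant w t0.
    have [b0 hb0] := grid_next_lt t0 e0.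
    exists b0 => // b _; case: ifPn => // b0b; exists (grid_floor b t) => //; split=> //=.
    have [|xe se te'] := te (grid_next (grid_floor b t) b).
      by rewrite ltW ?grid_next_gt//=; exact: hb0.
    split; first by rewrite /= se.
    by split; [exact/te'|rewrite /preimage/= xe].
  move=> [b0 _ h].
  have t0 : 0 <= t.
    by have := h b0 Logic.I; rewrite leqnn => -[a _ [_ []]].
  have [e e0 te] := right_constant w t0.
  have [b1 hb1] := grid_next_lt t0 e0.
  pose b := maxn b0 b1.
  have := h b Logic.I; rewrite leq_maxl => -[a _ [/= [sj [qt Bq]] [_ ga]]].
  have [|xe se te'] := te (grid_next a b).
    by rewrite -ga ltW ?grid_next_gt//=; apply: hb1; exact: leq_maxr.
  split=> //=; first by rewrite -se.
    by apply/te'.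
  by rewrite -xe.
apply: bigcup_measurable => b0 _; apply: bigcapT_measurable => b.
case: ifP => // _; apply: bigcup_measurable => a _; apply: measurableX.
  have g0 : 0 < grid_next a b :> R by rewrite divr_gt0.
  apply: measurableI; first exact: sigmaZ_st (ltW g0).
  by apply: measurableI; [exact: sigmaZ_lt_tau|exact: sigmaZ_xi (ltW g0) mB].
exact: measurable_grid_cell.
Qed.

Variables (s : R) (s0 : 0 < s) (theta : Omega -> R) (theta_exp : exp_time Z s theta).
Variables (k j : 'I_m) (g : RT -> R).
Hypotheses (mg : measurable_fun setT g) (g0 : forall y, 0 <= g y).

Let level_before (p : OmegaZ * RT) : \bar R :=
  ((fun p => (g (xi Z p.2 p.1))%:E) \_ (before_exit j setT)) p.

Let measurable_level_before : measurable_fun setT level_before.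
Proof.
apply/(measurable_restrictT _ _).1; first exact: measurable_before_exit.
apply/measurable_EFinP => mE B mB.
rewrite (_ : _ `&` _ = before_exit j (g @^-1` B)).
  apply: measurable_before_exit; rewrite -[X in measurable X]setTI; exact: mg.
by apply/seteqP; split=> p; [move=> [[? ? ? _] ?]; split|move=> [? ? ? ?]; split].
Qed.

Let level_before_ge0 p : (0 <= level_before p)%E.
Proof. by apply: erestrict_ge0 => q _; rewrite lee_fin. Qed.

(** The integrand is a jointly measurable function of the path and of [theta]; independence allows
    the time to be integrated against its exponential law with the path frozen. *)
Lemma integral_theta :
  (\int[P k]_(w in [set w | ((theta w)%:E < tau Z x T w)%E /\ st Z (theta w) w = j])
     (g (xi Z (theta w) w))%:E =
   \int[P k]_w \int[expo s0]_t level_before (w, t))%E.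
Proof.
have [th0 mth thl thi] := theta_exp.
have mth' : measurable_fun setT (theta : Omega -> RT) by exact: mth.
rewrite [LHS]integral_mkcond.
transitivity (\int[P k]_w level_before (w, theta w))%E.
  apply: eq_integral => w _; rewrite /level_before /patch.
  suff -> : (w \in [set w | ((theta w)%:E < tau Z x T w)%E /\ st Z (theta w) w = j]) =
     (((w : OmegaZ), (theta w : RT)) \in before_exit j setT) by [].
  apply/idP/idP; rewrite !inE; first by move=> [h1 h2]; split=> //; exact: th0.
  by move=> [].
have := @integral_indep _ _ _ Omega OmegaZ RT R (P k) (P k) (NngNum ler01) (expo s0)
  (id : Omega -> OmegaZ) (theta : Omega -> RT) level_before measurable_idZ mth'.
rewrite mul1e; apply => // A B mA mB.
rewrite mul1e; etransitivity; first exact (thi k A B mA mB).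
by congr (_ * _)%E; rewrite thl.
Qed.

Lemma measurable_epoch n l w : measurable ([set t | epoch Z n l w t] : set RT).
Proof.
rewrite (_ : [set t | _] = `[epoch_start Z n l w, epoch_end Z n l w[%classic)//.
Qed.

(** For a frozen path, the times before the exit at which the chain is in state j form a disjoint
    union of epochs, on each of which the integrand is constant. Indices that are not alive give an
    empty set of times and contribute 0. The enumeration [pr] makes a single series of the two
    indices. *)
Lemma integral_theta_epochs (pr : nat -> nat * nat) : bijective pr ->
  (\int[P k]_(w in [set w | ((theta w)%:E < tau Z x T w)%E /\ st Z (theta w) w = j])
     (g (xi Z (theta w) w))%:E =
   \sum_(q <oo) \int[P k]_(w in inside_at Z (pr q).1 (pr q).2 j T x)
     ((g (level Z (pr q).1 (pr q).2 w))%:E *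
      expo s0 [set t | epoch Z (pr q).1 (pr q).2 w t]))%E.
Proof.
move=> [rp prK rpK].
pose F q w := ((fun w => (g (level Z (pr q).1 (pr q).2 w))%:E *
      expo s0 [set t | epoch Z (pr q).1 (pr q).2 w t])%E
   \_ (inside_at Z (pr q).1 (pr q).2 j T x)) w.
have mA q : measurable (inside_at Z (pr q).1 (pr q).2 j T x).
  apply: measurableI; last exact: measurable_emb.
  exact: past_sub (@past_inside _ _ _ _ _ _ Z (pr q).1 (pr q).2 T x).
have mF q : measurable_fun setT (F q).
  apply/(measurable_restrictT _ _).1 => //; apply: measurable_funTS.
  apply: emeasurable_funM; last exact: measurable_epoch_prob.
  by apply/measurable_EFinP; exact (measurableT_comp mg (measurable_level Z _ _)).
have F0 q w : (0 <= F q w)%E.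
  by apply: erestrict_ge0 => u _; rewrite mule_ge0// lee_fin.
under [RHS]eq_eseriesr do rewrite integral_mkcond.
transitivity (\int[P k]_w \sum_(q <oo) F q w)%E; last by rewrite integral_nneseries.
etransitivity; first exact integral_theta.
apply: eq_integral => w _.
pose C q : set RT := if w \in inside_at Z (pr q).1 (pr q).2 j T x
  then [set t | epoch Z (pr q).1 (pr q).2 w t] else set0.
have Cepoch q t : C q t -> epoch Z (pr q).1 (pr q).2 w t /\
    inside_at Z (pr q).1 (pr q).2 j T x w.
  by rewrite /C; case: ifP => // + h; rewrite inE.
have mC q : measurable (C q) by rewrite /C; case: ifP => // _; exact: measurable_epoch.
have tC : trivIset setT C.
  move=> p q _ _ [t [/Cepoch[ep _] /Cepoch[eq _]]].
  apply: (can_inj prK); have := epoch_uniq ep eq.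
  by rewrite -!surjective_pairing.
have CE : [set t | before_exit j setT (w, t)] = \bigcup_q C q.
  apply/seteqP; split=> t.
    move=> [/= t0 stj tt _]; have [n [l e]] := epoch_ex Z w t0.
    exists (rp (n, l)) => //; rewrite /C rpK mem_set//=; split.
      exact/(lt_tauP I0 e).
    by rewrite /= -stj (st_epoch e).
  move=> [q _ /Cepoch[e [ins ej]]]; split=> //=.
  - by case/andP: e => + _; apply: le_trans; exact: epoch_start_ge0.
  - by rewrite (st_epoch e).
  - exact/(lt_tauP I0 e).
have xiC q : {in C q, (fun=> (g (level Z (pr q).1 (pr q).2 w))%:E) =1
     (fun t => (g (xi Z t w))%:E)}.
  by move=> t; rewrite inE => /Cepoch[e _]; rewrite (xi_epoch e).
transitivity (\int[expo s0]_(t in \bigcup_q C q) (g (xi Z t w))%:E)%E.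
  rewrite -CE [RHS]integral_mkcond; apply: eq_integral => t _.
  rewrite /level_before /patch.
  suff -> : ((w : OmegaZ, t : RT) \in before_exit j setT) =
      (t \in [set t | before_exit j setT (w, t)]) by [].
  by apply/idP/idP; rewrite !inE.
rewrite ge0_integral_bigcup//; last 2 first.
- apply/measurable_fun_bigcup => // q.
  exact: (eq_measurable_fun _ (xiC q)).
- by move=> t _; rewrite lee_fin.
apply: eq_eseriesr => q _.
rewrite -(eq_integral _ _ (xiC q)) integral_cst// /F /patch /C.
by case: ifPn => // _; rewrite measure0 mule0.
Qed.

End random_time.

(** * Exit at the end of a given epoch *)

Section exit_time.
Context {R : realType} {m : nat} {par : map_param R m}
  {d : measure_display} {Omega : measurableType d}
  {P : 'I_m -> probability Omega R} (Z : map_process par P).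
Variables (T x s : R).
Local Notation RT := (measurableTypeR R).
Local Notation I := (`]x - T, x[%classic : set R).
Hypotheses (I0 : I 0) (s0 : 0 < s).
Variable J : set RT.
Hypotheses (mJ : measurable J) (JI : forall y, J y -> ~ I y).
Variables k r : 'I_m.

Definition exit_event : set Omega :=
  [set w | [/\ (tau Z x T w < +oo)%E, J (xi_tau Z x T w) &
               st Z (fine (tau Z x T w)) w = r]].

Definition epoch_exit n l : set Omega :=
  [set w | [/\ alive Z n l w, inside Z T x n l w,
     J (xi Z (epoch_end Z n l w) w) & st Z (epoch_end Z n l w) w = r]].

Definition jump_exit n l (j : 'I_m) : set Omega :=
  inside_at Z n l j T x `&`
    [set w | alive Z n l.+1 w /\ J (level Z n l w + kappa Z n l w)].

Definition trans_exit n l (j : 'I_m) : set Omega :=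
  inside_at Z n l j T x `&` [set w | emb Z n.+1 w = r] `&`
    [set w | [/\ alive Z n l w, ~~ alive Z n l.+1 w &
                 J (level Z n l w + chi Z n w)]].

Lemma epoch_exit_tau n l w : epoch_exit n l w ->
  tau Z x T w = (epoch_end Z n l w)%:E.
Proof. by move=> [a ins Jx _]; apply: exit_tau => //; exact: JI. Qed.

(** As [J] avoids the interval, landing in [J] at the end of an inside epoch is the first exit;
    conversely every exit ends such an epoch. *)
Lemma exit_eventE (pr : nat -> nat * nat) : bijective pr ->
  exit_event = \bigcup_q epoch_exit (pr q).1 (pr q).2.
Proof.
move=> [rp prK rpK]; apply/seteqP; split=> w.
  move=> [tfin Jw stw]; have [n [l [a ins tE]]] := exit_ex I0 tfin.
  exists (rp (n, l)) => //; rewrite rpK; split=> //=.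
    by move: Jw; rewrite /xi_tau tE.
  by move: stw; rewrite tE.
move=> [q _ Hq]; have tE := epoch_exit_tau Hq; have [a ins Jx sx] := Hq.
by split; rewrite /xi_tau tE ?ltry.
Qed.

Lemma trivIset_epoch_exit (pr : nat -> nat * nat) : bijective pr ->
  trivIset setT (fun q => epoch_exit (pr q).1 (pr q).2).
Proof.
move=> [rp prK rpK] p q _ _ [w [Hp Hq]]; apply: (can_inj prK).
have [a _ _ _] := Hp; have [a' _ _ _] := Hq.
have := epoch_end_inj a a'; rewrite -!surjective_pairing; apply.
by have := epoch_exit_tau Hp; rewrite (epoch_exit_tau Hq) => -[].
Qed.

Lemma measurable_inside_at n l (j : 'I_m) : measurable (inside_at Z n l j T x).
Proof.
apply: measurableI; last exact: measurable_emb.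
exact: past_sub (@past_inside _ _ _ _ _ _ Z n l T x).
Qed.

Lemma measurable_stay_start n : measurable_fun setT (stay_start Z n).
Proof. by apply: measurable_sum => i; exact: measurable_zeta. Qed.

Lemma measurable_jump_clock n l : measurable_fun setT (jump_clock Z n l).
Proof. by apply: measurable_sum => i; exact: measurable_eta. Qed.

Lemma measurable_alive n l : measurable [set w | alive Z n l w].
Proof.
by apply: measurable_lt_set; [exact: measurable_jump_clock|exact: measurable_zeta].
Qed.

Lemma measurable_jump_exit n l j : measurable (jump_exit n l j).
Proof.
apply: measurableI; first exact: measurable_inside_at.
rewrite (_ : [set w | _] = [set w | alive Z n l.+1 w] `&`
   (fun w => level Z n l w + kappa Z n l w) @^-1` J)//.
apply: measurableI; first exact: measurable_alive.
rewrite -[X in measurable X]setTI.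
have mm : measurable_fun setT (fun w => level Z n l w + kappa Z n l w).
  by apply: measurable_funD; [exact: measurable_level|exact: measurable_kappa].
exact: (mm measurableT _ mJ).
Qed.

Lemma measurable_trans_exit n l j : measurable (trans_exit n l j).
Proof.
apply: measurableI.
  by apply: measurableI; [exact: measurable_inside_at|exact: measurable_emb].
rewrite (_ : [set w | _] = [set w | alive Z n l w] `&` (~` [set w | alive Z n l.+1 w] `&`
   (fun w => level Z n l w + chi Z n w) @^-1` J)); last first.
  by apply/seteqP; split=> w; [move=> [? /negP ? ?]|move=> [? [/negP ? ?]]].
apply: measurableI; first exact: measurable_alive.
apply: measurableI; first by apply: measurableC; exact: measurable_alive.
rewrite -[X in measurable X]setTI.
have mm : measurable_fun setT (fun w => level Z n l w + chi Z n w).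
  by apply: measurable_funD; [exact: measurable_level|exact: measurable_chi].
exact: (mm measurableT _ mJ).
Qed.

(** A jump of xi inside a stay leaves the state unchanged and counts for r = j only. A transition
    may also lead from j to j, so that both terms are present when r = j; [alive n l.+1] keeps them
    disjoint. *)
Lemma epoch_exit_split n l j : epoch_exit n l `&` [set w | emb Z n w = j] =
  (if j == r then jump_exit n l j else set0) `|` trans_exit n l j.
Proof.
apply/seteqP; split=> w.
  move=> [[a ins Jw sw] ej].
  have [a'|na] := boolP (alive Z n l.+1 w).
    left; have jr : j = r by rewrite -ej -sw st_end_jump.
    rewrite jr eqxx; split; first by split=> //=; rewrite ej.
    by split=> //; move: Jw; rewrite xi_end_jump.
  right; split.
    split; first by split.
    by rewrite /= -sw st_end_trans.
  by split=> //; move: Jw; rewrite xi_end_trans.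
move=> [|[[[ins ej] er] [a na Jw]]].
  case: eqP => // -> [[ins ej] [a Jw]]; split=> //; split=> //.
  - exact: aliveW a.
  - by rewrite xi_end_jump.
  - by rewrite st_end_jump.
split=> //; split=> //; first by rewrite xi_end_trans.
by rewrite st_end_trans.
Qed.

Lemma measurable_epoch_exit_emb n l j :
  measurable (epoch_exit n l `&` [set w | emb Z n w = j]).
Proof.
rewrite epoch_exit_split; apply: measurableU; last exact: measurable_trans_exit.
by case: ifP => // _; exact: measurable_jump_exit.
Qed.

Lemma epoch_exitE n l :
  epoch_exit n l = \big[setU/set0]_(j < m) (epoch_exit n l `&` [set w | emb Z n w = j]).
Proof.
rewrite -big_distrr/= -[LHS]setIT; congr (_ `&` _).
apply/esym/seteqP; split=> // w _; rewrite -bigcup_seq.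
by exists (emb Z n w) => //=; rewrite mem_index_enum.
Qed.

Lemma measurable_epoch_exit n l : measurable (epoch_exit n l).
Proof. by rewrite epoch_exitE; apply: bigsetU_measurable => j _; exact: measurable_epoch_exit_emb. Qed.

Lemma measurable_discount n l :
  measurable_fun setT (fun w => (expR (- (s * epoch_end Z n l w)))%:E).
Proof.
apply/measurable_EFinP; apply: (measurableT_comp (@measurable_expR R)).
apply: (measurableT_comp (@oppr_measurable R setT)).
apply: measurable_funM => //; apply: measurable_minr; first exact: measurable_stay_start.
by apply: measurable_funD; [exact: measurable_stay_start|exact: measurable_jump_clock].
Qed.

Lemma integral_epoch_exit n l :
  (\int[P k]_(w in epoch_exit n l) (expR (- (s * epoch_end Z n l w)))%:E =
   \sum_(j < m) ((j == r)%:R%:E * \int[P k]_(w in jump_exit n l j)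
                    (expR (- (s * epoch_start Z n l.+1 w)))%:E +
                 \int[P k]_(w in trans_exit n l j)
                    (expR (- (s * stay_start Z n.+1 w)))%:E))%E.
Proof.
rewrite {1}epoch_exitE ge0_integral_bigsetU//; last 4 first.
- by move=> j; exact: measurable_epoch_exit_emb.
- exact: index_enum_uniq.
- by move=> i j _ _ [w [[_ /= <-] [_ /= <-]]].
- exact: (measurable_funTS (measurable_discount n l)).
apply: eq_bigr => j _; rewrite epoch_exit_split ge0_integral_setU//; last 4 first.
- by case: ifP => // _; exact: measurable_jump_exit.
- exact: measurable_trans_exit.
- exact: (measurable_funTS (measurable_discount n l)).
- apply/disj_set2P; rewrite -subset0 => w []; case: ifP => // _ [_ [a _]] [_ [_ + _]].
  by rewrite a.
congr (_ + _)%E.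
  case: ifP => _; last by rewrite integral_set0 mul0e.
  rewrite mul1e; apply: eq_integral => w; rewrite inE => -[_ [a _]].
  by rewrite epoch_end_jump.
apply: eq_integral => w; rewrite inE => -[_ [_ na _]].
by rewrite epoch_end_trans.
Qed.

Definition exit_kernel (j : 'I_m) (y : R) : R :=
  dK0 par [set q | J (y + q)] j r.

Lemma exit_kernelE j y : exit_kernel j y =
  nu par j * (ptrans par j r * fine (trans_law par j r [set q | J (y + q)])) +
  (j == r)%:R * (lam par j * fine (jump_law par j [set q | J (y + q)])).
Proof.
rewrite /exit_kernel /dK0 mxE /mxN /mxLambda !mul_diag_mx !mxE.
by congr (_ + _); case: eqP => _; rewrite ?mulr1n ?mulr0n ?mul1r ?mulr0 ?mul0r.
Qed.

Lemma exit_kernel_ge0 j y : 0 <= exit_kernel j y.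
Proof.
rewrite exit_kernelE addr_ge0//.
  rewrite mulr_ge0 ?(ltW (nu_gt0 par j))// mulr_ge0 ?ptrans_ge0//.
  by rewrite fine_ge0.
by rewrite mulr_ge0// mulr_ge0 ?(ltW (lam_gt0 par j))// fine_ge0.
Qed.

Let measurable_shift y : measurable [set q : RT | J (y + q)].
Proof.
rewrite -[X in measurable X]setTI.
have mm : measurable_fun setT (fun q : RT => y + q) by exact: measurable_funD.
exact: (mm measurableT _ mJ).
Qed.

(** The bound is the total rate of events in state j. It makes the integrals against [dH] finite. *)
Lemma exit_kernel_le j y : exit_kernel j y <= nu par j + lam par j.
Proof.
have fine_le1 (law : probability RT R) : fine (law [set q | J (y + q)]) <= 1.
  by rewrite -lee_fin fineK ?fin_num_measure// probability_le1.
have p1 : ptrans par j r <= 1.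
  rewrite -(ptrans_sum1 par j) (bigD1 r)//= lerDl.
  by apply: sumr_ge0 => i _; exact: ptrans_ge0.
rewrite exit_kernelE lerD//.
  rewrite ler_piMr ?(ltW (nu_gt0 par j))// mulr_ile1 ?ptrans_ge0//.
  by rewrite fine_ge0.
rewrite -[leRHS]mul1r ler_pM ?mulr_ge0 ?fine_ge0 ?(ltW (lam_gt0 par j))//.
  by case: eqP.
by rewrite ler_piMr ?(ltW (lam_gt0 par j)).
Qed.

Lemma exit_kernel_EFin j y : (exit_kernel j y)%:E =
  ((ptrans par j r * nu par j)%:E * trans_law par j r [set q | J (y + q)%R] +
   ((j == r)%:R * lam par j)%:E * jump_law par j [set q | J (y + q)%R])%E.
Proof.
rewrite exit_kernelE EFinD; congr (_ + _)%E.
  rewrite mulrCA mulrA EFinM fineK// fin_num_measure//.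
by rewrite mulrA EFinM fineK// fin_num_measure.
Qed.

Lemma measurable_exit_kernel j : measurable_fun setT (exit_kernel j : RT -> R).
Proof.
apply/measurable_EFinP; rewrite (_ : EFin \o _ = fun y => (exit_kernel j y)%:E)//.
under eq_fun do rewrite exit_kernel_EFin.
by apply: emeasurable_funD; apply: emeasurable_funM => //;
  exact: measurable_shift_prob.
Qed.

Let total j := nu par j + lam par j + s.
Let total0 j : 0 < total j. Proof. by rewrite /total !addr_gt0// ?nu_gt0 ?lam_gt0. Qed.

Lemma exit_epoch_identity n l j :
  (s%:E * ((j == r)%:R%:E * \int[P k]_(w in jump_exit n l j)
                    (expR (- (s * epoch_start Z n l.+1 w)))%:E +
                 \int[P k]_(w in trans_exit n l j)
                    (expR (- (s * stay_start Z n.+1 w)))%:E) =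
   \int[P k]_(w in inside_at Z n l j T x)
     ((exit_kernel j (level Z n l w))%:E * expo s0 [set t | epoch Z n l w t]))%E.
Proof.
rewrite (integral_epoch_theta Z k n l j T x s0 (measurable_exit_kernel j)
  (exit_kernel_ge0 j)).
rewrite /jump_exit integral_epoch_jump// /trans_exit integral_epoch_trans//.
have mA := measurable_inside_at n l j.
have mw : measurable_fun setT (EFin \o weight Z n l j s).
  by apply/measurable_EFinP; exact: measurable_weight.
have ml (law : probability RT R) :
    measurable_fun setT (fun w => law [set q | J (level Z n l w + q)]).
  exact (measurableT_comp (measurable_shift_prob law mJ) (measurable_level Z n l)).
set tr := (\int[P k]_(w in _) ((weight Z n l j s w)%:E * trans_law _ _ _ _))%E.
set ju := (\int[P k]_(w in _) ((weight Z n l j s w)%:E * jump_law _ _ _))%E.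
have -> : (\int[P k]_(w in inside_at Z n l j T x)
    ((weight Z n l j s w)%:E * (exit_kernel j (level Z n l w))%:E) =
    (ptrans par j r * nu par j)%:E * tr + ((j == r)%:R * lam par j)%:E * ju)%E.
  have mtr : measurable_fun (inside_at Z n l j T x) (fun w =>
      (weight Z n l j s w)%:E * trans_law par j r [set q | J (level Z n l w + q)%R])%E.
    by apply: measurable_funTS; apply: emeasurable_funM.
  have mju : measurable_fun (inside_at Z n l j T x) (fun w =>
      (weight Z n l j s w)%:E * jump_law par j [set q | J (level Z n l w + q)%R])%E.
    by apply: measurable_funTS; apply: emeasurable_funM.
  have tr0 w : (0 <= (weight Z n l j s w)%:E *
      trans_law par j r [set q | J (level Z n l w + q)%R])%E.
    by rewrite mule_ge0// lee_fin expR_ge0.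
  have ju0 w : (0 <= (weight Z n l j s w)%:E *
      jump_law par j [set q | J (level Z n l w + q)%R])%E.
    by rewrite mule_ge0// lee_fin expR_ge0.
  have c1 : 0 <= ptrans par j r * nu par j.
    by rewrite mulr_ge0 ?ptrans_ge0// ltW// nu_gt0.
  have c2 : 0 <= (j == r)%:R * lam par j by rewrite mulr_ge0// ltW// lam_gt0.
  rewrite /tr /ju -!ge0_integralZl_EFin// -ge0_integralD//; last 4 first.
  - by move=> w _; rewrite mule_ge0.
  - exact: emeasurable_funM.
  - by move=> w _; rewrite mule_ge0.
  - exact: emeasurable_funM.
  apply: eq_integral => w _; rewrite exit_kernel_EFin ge0_muleDr; last 2 first.
  - by rewrite mule_ge0// lee_fin.
  - by rewrite mule_ge0// lee_fin.
  by congr (_ + _)%E; rewrite muleCA.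
have tr0 : (0 <= tr)%E.
  by apply: integral_ge0 => w _; rewrite mule_ge0// lee_fin expR_ge0.
have ju0 : (0 <= ju)%E.
  by apply: integral_ge0 => w _; rewrite mule_ge0// lee_fin expR_ge0.
have K1 : 0 <= lam par j / (nu par j + lam par j + s).
  by rewrite divr_ge0// ltW// ?lam_gt0// total0.
have K2 : 0 <= ptrans par j r * (nu par j / (nu par j + lam par j + s)).
  by rewrite mulr_ge0 ?ptrans_ge0// divr_ge0// ltW// ?nu_gt0// total0.
have c1 : 0 <= ptrans par j r * nu par j.
  by rewrite mulr_ge0 ?ptrans_ge0// ltW// nu_gt0.
have c2 : 0 <= (j == r)%:R * lam par j by rewrite mulr_ge0// ltW// lam_gt0.
rewrite ge0_muleDr; last 2 first.
- by rewrite !mule_ge0// lee_fin.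
- by rewrite !mule_ge0// lee_fin.
rewrite [RHS]ge0_muleDr; last 2 first.
- by rewrite !mule_ge0// lee_fin.
- by rewrite !mule_ge0// lee_fin.
(* Only coefficients are left to compare: s (lambda_j / total) = (s / total) lambda_j, and likewise
   with p_{jr} nu_j. *)
rewrite [RHS]addeC !muleA -!EFinM; congr (_ * _ + _ * _)%E; congr EFin; field;
  by rewrite gt_eqF// total0.
Qed.

End exit_time.

(** * Summation over the epochs *)

Section compensation.
Context {R : realType} {m : nat} {par : map_param R m}
  {d : measure_display} {Omega : measurableType d}
  {P : 'I_m -> probability Omega R} (Z : map_process par P).
Variables (T x s : R).
Local Notation RT := (measurableTypeR R).
Local Notation I := (`]x - T, x[%classic : set R).
Hypotheses (I0 : I 0) (s0 : 0 < s).
Variables (theta : Omega -> R) (theta_exp : exp_time Z s theta).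
Variable k : 'I_m.

(** Here the process is alive in the sense that [theta] precedes the exit, whereas [alive n l]
    refers to the sojourn time. *)
Definition alive_at (j : 'I_m) : set Omega :=
  [set w | ((theta w)%:E < tau Z x T w)%E /\ st Z (theta w) w = j].

Let theta0 w : 0 <= theta w. Proof. by case: theta_exp. Qed.

Lemma measurable_alive_at j (B : set RT) : measurable B ->
  measurable (alive_at j `&` [set w | B (xi Z (theta w) w)]).
Proof.
move=> mB; have mth : measurable_fun setT (theta : Omega -> RT) by case: theta_exp.
have mpair : measurable_fun setT (fun w : Omega => ((w : OmegaZ Z), (theta w : RT))).
  apply/measurable_fun_pair; first exact: (@measurable_idZ _ _ _ _ _ _ Z).
  exact: mth.
rewrite (_ : _ `&` _ = (fun w : Omega => ((w : OmegaZ Z), (theta w : RT))) @^-1`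
   before_exit (Z := Z) T x j B).
  rewrite -[X in measurable X]setTI.
  exact: (mpair measurableT _ (measurable_before_exit I0 j mB)).
rewrite /preimage /before_exit /=; apply/seteqP; split=> w.
  by move=> [[tt sj] Bx]; split.
by move=> [? ? ? ?]; split.
Qed.

Lemma measurable_alive_atT j : measurable (alive_at j).
Proof.
have := measurable_alive_at j measurableT.
by rewrite (_ : [set w | _] = setT) ?setIT//; apply/seteqP.
Qed.

(** The position at [theta] is shown measurable on [alive_at j] only. Elsewhere it is replaced by 0,
    a value that the restriction of [P k] to this event discards. *)
Let X j w : RT := if w \in alive_at j then xi Z (theta w) w else 0.

Let mX j : measurable_fun setT (X j).
Proof.
move=> _ B mB; rewrite setTI.
rewrite (_ : X j @^-1` B = (alive_at j `&` [set w | B (xi Z (theta w) w)]) `|`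
   (~` alive_at j `&` (if 0 \in B then setT else set0))).
  apply: measurableU; first exact: measurable_alive_at.
  apply: measurableI; first by apply: measurableC; exact: measurable_alive_atT.
  by case: ifP.
apply/seteqP; split=> w; rewrite /preimage/= /X.
  case: ifPn; rewrite ?inE ?notin_setE => wA Bw; first by left.
  by right; split=> //; rewrite mem_set.
move=> [[wA Bw]|[nA]]; first by rewrite mem_set.
by rewrite memNset//; case: ifPn => //; rewrite inE.
Qed.

Lemma dHE j (B : set RT) :
  dH Z theta T x B k j = fine (P k (alive_at j `&` [set w | B (xi Z (theta w) w)])).
Proof.
rewrite /dH /Pmx mxE; congr (fine (P k _)); apply/seteqP; split=> w.
  by move=> [[Bw tt] [_ sj]].
by move=> [[tt sj] Bw]; split; split; rewrite /= ?ltry.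
Qed.

(** On measurable sets, the entry of [dH] is the law of [X j] under the restriction of [P k] to
    [alive_at j]. The integrand [h] has to agree with a measurable nonnegative [g] on the interval
    only, since before the exit xi does not leave it. *)
Lemma integral_dH j (g h : RT -> R) : measurable_fun setT g -> (forall y, 0 <= g y) ->
  (forall y, I y -> h y = g y) ->
  (\int[fun B : set RT => (dH Z theta T x B k j)%:E]_(y in I) (h y)%:E =
   \int[P k]_(w in alive_at j) (g (xi Z (theta w) w))%:E)%E.
Proof.
move=> mg g0 hg.
have mA := measurable_alive_atT j.
pose law : {measure set RT -> \bar R} := image_measure (mrestr (P k) mA) (mX j).
pose nu (B : set RT) : \bar R := (dH Z theta T x B k j)%:E.
have nuE B : measurable B -> nu B = law B.
  move=> mB; rewrite /nu dHE fineK; last first.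
    by rewrite fin_num_measure//; exact: measurable_alive_at.
  rewrite /law /= /image_measure /pushforward /= /mrestr; congr (P k _).
  apply/seteqP; split=> w; rewrite /preimage/= /X.
    by move=> [wA Bw]; rewrite mem_set.
  by move=> [+ wA]; rewrite mem_set.
have nu0 : nu set0 = 0%E by rewrite nuE.
have nu_ge0 B : (0 <= nu B)%E by rewrite lee_fin dHE fine_ge0.
have nu_additive : semi_sigma_additive nu.
  move=> F mF tF mUF; rewrite nuE//.
  under eq_fun do (under eq_bigr do rewrite nuE//).
  exact: measure_semi_sigma_additive.
(* The bare set function under the integral is given its measure structure, so that the theory of
   measures applies to it. *)
pose nuM : {measure set RT -> \bar R} :=
  HB.pack nu (isMeasure.Build _ _ _ nu nu0 nu_ge0 nu_additive).
transitivity (\int[nuM]_(y in I) (g y)%:E)%E.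
  by apply: (@eq_integral _ _ _ nuM) => y; rewrite inE => /hg ->.
rewrite (eq_measure_integral law); last by move=> B mB _; exact: nuE.
have mgE : measurable_fun setT (EFin \o g) by exact/measurable_EFinP.
have mgI : measurable_fun setT ((EFin \o g) \_ I).
  by apply/(measurable_restrictT _ _).1 => //; exact: measurable_funTS.
have gI0 y : (0 <= ((EFin \o g) \_ I) y)%E.
  by apply: erestrict_ge0 => u _; rewrite lee_fin.
rewrite integral_mkcond /law (ge0_integral_pushforward (mX j))//.
rewrite preimage_setT ge0_integral_mrestr//; last 2 first.
- by exact (measurableT_comp mgI (mX j)).
- by move=> w; exact: gI0.
apply: eq_integral => w wA; rewrite /= /X wA /patch mem_set//.
by apply: (tau_xi I0) => //; move: wA; rewrite inE => -[].
Qed.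

Lemma integral_alive_at_fin j (g : RT -> R) (c : R) : measurable_fun setT g ->
  (forall y, 0 <= g y <= c) ->
  (\int[P k]_(w in alive_at j) (g (xi Z (theta w) w))%:E)%E \is a fin_num.
Proof.
move=> mg gc; have mA := measurable_alive_atT j.
rewrite (eq_integral (EFin \o (g \o X j))); last by move=> w wA; rewrite /= /X wA.
have mgX : measurable_fun (alive_at j) (EFin \o (g \o X j)).
  by apply/measurable_EFinP/measurable_funTS; exact: (measurableT_comp mg (mX j)).
have g0 w : (0 <= (EFin \o (g \o X j)) w)%E.
  by rewrite lee_fin; case/andP: (gc (X j w)).
rewrite ge0_fin_numE ?integral_ge0//.
apply: (@le_lt_trans _ _ (\int[P k]_(w in alive_at j) c%:E)%E).
  by apply: ge0_le_integral => // w _; rewrite lee_fin; case/andP: (gc (X j w)).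
by rewrite integral_cst// ltey_eq fin_numM// fin_num_measure.
Qed.

Variables (J : set RT) (r : 'I_m).
Hypotheses (mJ : measurable J) (JI : forall y, J y -> ~ I y).

(** Both sides are series over the epochs with equal terms. Nonnegativity of the terms justifies the
    exchange of the series with the sum over the states. *)
Lemma exit_identity :
  (s%:E * \int[P k]_(w in exit_event Z T x J r) (expR (- s * fine (tau Z x T w)))%:E =
   \sum_(j < m) \int[P k]_(w in alive_at j) (exit_kernel (par := par) J r j (xi Z (theta w) w))%:E)%E.
Proof.
have /card_esym/ppcard_eqP[f] := card_nat2.
have bf : bijective (f : nat -> nat * nat) by exact: bijTT.
have [rp prK rpK] := bf.
have mD q : measurable (epoch_exit Z T x J r (f q).1 (f q).2).
  exact: measurable_epoch_exit.
have discE q : {in epoch_exit Z T x J r (f q).1 (f q).2,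
    (fun w => (expR (- (s * epoch_end Z (f q).1 (f q).2 w)))%:E) =1
    (fun w => (expR (- s * fine (tau Z x T w)))%:E)}.
  by move=> w; rewrite inE => Hw; rewrite (epoch_exit_tau JI Hw) mulNr.
rewrite (exit_eventE Z I0 JI r bf) ge0_integral_bigcup//; last 2 first.
- apply/measurable_fun_bigcup => // q; apply: (eq_measurable_fun _ (discE q)).
  exact: (measurable_funTS (measurable_discount Z s _ _)).
- exact: (trivIset_epoch_exit JI bf).
rewrite -nneseriesZl; last by move=> q _; apply: integral_ge0 => w _; rewrite lee_fin expR_ge0.
transitivity (\sum_(q <oo) \sum_(j < m) \int[P k]_(w in inside_at Z (f q).1 (f q).2 j T x)
     ((exit_kernel (par := par) J r j (level Z (f q).1 (f q).2 w))%:E *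
      expo s0 [set t | epoch Z (f q).1 (f q).2 w t]))%E.
  apply: eq_eseriesr => q _.
  rewrite -(eq_integral _ _ (discE q)) integral_epoch_exit//.
  rewrite ge0_sume_distrr; last first.
    by move=> j _; rewrite adde_ge0// ?mule_ge0// ?lee_fin//;
      apply: integral_ge0 => w _; rewrite lee_fin expR_ge0.
  by apply: eq_bigr => j _; rewrite (exit_epoch_identity Z T x s0 mJ).
rewrite nneseries_sum; last first.
  by move=> j q _; apply: integral_ge0 => w _; rewrite mule_ge0// lee_fin exit_kernel_ge0.
apply: eq_bigr => j _.
rewrite -(integral_theta_epochs I0 s0 theta_exp k j (measurable_exit_kernel (par := par) mJ r j)
  (exit_kernel_ge0 (par := par) J r j) bf).
by [].
Qed.

End compensation.

(** * Absence of atoms on the positive half-line *)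

Section no_atom.
Context {R : realType} {m : nat} (par : map_param R m).
Local Notation RT := (measurableTypeR R).

(* The exponential upper tail makes F_k^0 continuous on ]0, +oo[. *)
Lemma jump_law_set1 k (u : R) : 0 < u -> jump_law par k ([set u] : set RT) = 0%E.
Proof.
move=> u0; set F := jump_law par k.
have c0 := cpos_gt0 par k; set c := cpos par k in c0.
have Ffin A : measurable A -> (fine (F A))%:E = F A.
  by move=> mA; rewrite fineK// fin_num_measure.
(* The atom at u is at most the mass of [u, u + e[, that is C e^{-c u} (1 - e^{-c e}) with C at most
   1, hence at most c e. *)
have le e : 0 < e -> fine (F ([set u] : set RT)) <= c * e.
  move=> e0.
  have h1 := jump_law_pos par k u0; have h2 := jump_law_pos par k (addr_gt0 u0 e0).
  rewrite -/F -/c in h1 h2.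
  set C := 1 - fine (F `]-oo, 0[%classic) in h1 h2.
  have C1 : C <= 1 by rewrite lerBlDr lerDl fine_ge0.
  have C0 : 0 <= C.
    by rewrite subr_ge0 -lee_fin Ffin// probability_le1.
  have sub : fine (F ([set u] : set RT)) + fine (F `]-oo, u[%classic) <=
      fine (F `]-oo, (u + e)%R[%classic).
    rewrite -lee_fin EFinD !Ffin// -measureU//; last first.
      by rewrite -subset0 => t [/= ->]; rewrite in_itv/= ltxx.
    apply: le_measure; rewrite ?inE//; first exact: measurableU.
    move=> t [->|]; rewrite /= !in_itv/= ?ltrDl// => tu.
    by apply: lt_trans tu _; rewrite ltrDl.
  have -> : c * e = 1 - (1 - c * e) by ring.
  have h3 : 1 - c * e <= expR (- c * e) by rewrite mulNr; exact: expR_ge1Dx.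
  have h4 : expR (- c * u) <= 1 by rewrite expR_le1 mulNr oppr_le0 mulr_ge0// ltW.
  have h5 : expR (- c * (u + e)) = expR (- c * u) * expR (- c * e).
    by rewrite mulrDr expRD.
  have h6 : 0 < expR (- c * u) by exact: expR_gt0.
  rewrite h5 in h2.
  move: h1 h2 sub h3 h4 h6 C0 C1.
  set a := fine (F ([set u] : set RT)); set b := fine (F _); set b' := fine (F _).
  set p := expR (- c * u); set q := expR (- c * e) => h1 h2 sub h3 h4 h6 C0 C1.
  have : a <= C * p * (1 - q) by nra.
  have q1 : q <= 1 by rewrite /q expR_le1 mulNr oppr_le0 mulr_ge0// ltW.
  have : C * p * (1 - q) <= 1 - q.
    by rewrite -[leRHS]mul1r ler_wpM2r ?subr_ge0// mulr_ile1// ltW.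
  lra.
rewrite -[LHS](Ffin _ (measurable_set1 u)); congr EFin.
apply/eqP; rewrite eq_le fine_ge0 ?measure_ge0// andbT leNgt; apply/negP => pos.
(* With e equal to the atom divided by 2 c, the bound says that the atom is at most half of
   itself. *)
have := le (fine (F ([set u] : set RT)) / (2 * c)).
rewrite divr_gt0 ?mulr_gt0// => /(_ isT).
rewrite (_ : c * (_ / (2 * c)) = fine (F ([set u] : set RT)) / 2); last first.
  by field; rewrite gt_eqF.
by lra.
Qed.

(** The exit event is strict, while [K0bar] is the mass of a closed half-line. They match at u > 0:
    the jump laws have no atom there and the transition jumps put no mass there. *)
Lemma K0bar_open (u : R) : 0 < u -> K0bar par u = dK0 par `]u, +oo[%classic.
Proof.
move=> u0; rewrite /K0bar.
have jl k : jump_law par k `[u, +oo[%classic = jump_law par k `]u, +oo[%classic.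
  have -> : `[u, +oo[%classic = [set u] `|` `]u, +oo[%classic :> set RT.
    by rewrite setU1itv.
  rewrite measureU//; last by rewrite -subset0 => t [/= ->]; rewrite in_itv/= ltxx.
  transitivity (0 + jump_law par k `]u, +oo[%classic)%E; last by rewrite add0e.
  by apply: f_equal2 => //; exact (jump_law_set1 k u0).
have tl k r (B : set RT) : measurable B -> B `<=` `]0%R, +oo[%classic -> trans_law par k r B = 0%E.
  move=> mB Bs; apply/eqP; rewrite -measure_le0 -(trans_law_le0 par k r).
  by apply: le_measure; rewrite ?inE.
have eF : mxF par `[u, +oo[%classic = mxF par `]u, +oo[%classic.
  apply/matrixP => k r; rewrite !mxE !tl//.
    by move=> t; rewrite /= !in_itv/= !andbT; exact: lt_trans.
  by move=> t; rewrite /= !in_itv/= !andbT; exact: lt_le_trans.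
have eF0 : mxF0 par `[u, +oo[%classic = mxF0 par `]u, +oo[%classic.
  by rewrite /mxF0; congr diag_mx; apply/matrixP => i k; rewrite !mxE jl.
by rewrite /dK0 eF eF0.
Qed.

End no_atom.

(** * The matrix identity for a general exit set *)

Section exit_matrix.
Context {R : realType} {m : nat} {par : map_param R m}
  {d : measure_display} {Omega : measurableType d}
  {P : 'I_m -> probability Omega R} (Z : map_process par P).
Variables (T x s : R).
Local Notation RT := (measurableTypeR R).
Local Notation I := (`]x - T, x[%classic : set R).
Hypotheses (I0 : I 0) (s0 : 0 < s).
Variables (theta : Omega -> R) (theta_exp : exp_time Z s theta).
Variable J : set RT.
Hypotheses (mJ : measurable J) (JI : forall y, J y -> ~ I y).

(** [D] is prescribed on finite exit times only, as [at_state] already restricts to them, and [G] on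
    the interval only, which is where it is integrated. *)
Lemma exit_matrix_identity (D : set Omega) (G : R -> 'M[R]_m) :
  D `&` [set w | (tau Z x T w < +oo)%E] =
    [set w | (tau Z x T w < +oo)%E /\ J (xi_tau Z x T w)] ->
  (forall y, I y -> G y = dK0 par [set q | J (y + q)]) ->
  s *: Emx Z (tau Z x T) (fun w => expR (- s * fine (tau Z x T w))) D =
  mxint (dH Z theta T x) I G.
Proof.
move=> DJ GK; apply/matrixP => k r; rewrite /mxint !mxE.
have DE : D `&` at_state Z (tau Z x T) r = exit_event Z T x J r.
  rewrite (_ : at_state Z (tau Z x T) r = [set w | (tau Z x T w < +oo)%E] `&`
    [set w | st Z (fine (tau Z x T w)) w = r])//.
  by rewrite setIA DJ; apply/seteqP; split=> w; [move=> [[? ?] ?]; split|move=> [? ? ?]; do 2 ?split].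
have intE j : (\int[fun B : set RT => (dH Z theta T x B k j)%:E]_(y in I) (G y j r)%:E =
    \int[P k]_(w in alive_at Z T x theta j)
       (exit_kernel (par := par) J r j (xi Z (theta w) w))%:E)%E.
  apply: (integral_dH I0 theta_exp k j (measurable_exit_kernel (par := par) mJ r j)
     (exit_kernel_ge0 (par := par) J r j)) => y Iy.
  by rewrite /exit_kernel GK.
have int_fin j : (\int[P k]_(w in alive_at Z T x theta j)
    (exit_kernel (par := par) J r j (xi Z (theta w) w))%:E)%E \is a fin_num.
  have mg := measurable_exit_kernel (par := par) mJ r j.
  have gb y : 0 <= exit_kernel (par := par) J r j y <= nu par j + lam par j.
    by rewrite exit_kernel_ge0 exit_kernel_le.
  exact (integral_alive_at_fin I0 theta_exp k j mg gb).
rewrite /Rintegral DE.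
have := exit_identity I0 s0 theta_exp k r mJ JI.
set lhs := (\int[P k]_(w in _) _)%E => idE.
have lhs_fin : lhs \is a fin_num.
  have lhs0 : (0 <= lhs)%E by apply: integral_ge0 => w _; rewrite lee_fin expR_ge0.
  (* Finiteness is read off from the other side, a finite sum of bounded integrals, and passes to
     the exit functional because s > 0. *)
  have : (s%:E * lhs)%E \is a fin_num by rewrite idE; apply/sum_fin_numP => j _ _.
  by move: lhs0; case: (lhs) => [||]//= _; rewrite gt0_muley ?lte_fin.
have -> : s * fine lhs = fine (s%:E * lhs)%E by rewrite fineM.
rewrite idE -sum_fine//.
by apply: eq_bigr => j _; rewrite /entry_int intE.
Qed.

End exit_matrix.

Theorem theorem3 (R : realType) (m : nat) (par : map_param R m)
    (d : measure_display) (Omega : measurableType d)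
    (P : 'I_m -> probability Omega R) (Z : map_process par P)
    (m_gt0 : (0 < m)%N)
    (Zirr : irreducible_chain Z) (Znonper : nonperiodic_chain Z)
    (Zcum : is_cumulant Z (Psi par))
    (s : R) (s_gt0 : 0 < s)
    (theta : Omega -> R) (theta_exp : exp_time Z s theta)
    (T x : R) (T_gt0 : 0 < T) (x_gt0 : 0 < x) (x_ltT : x < T) :
  (forall z, x < z ->
     s *: Emx Z (tau Z x T) (fun w => expR (- s * fine (tau Z x T w)))
            ([set w | z < xi_tau Z x T w] `&` A_plus Z x T) =
     mxint (dH Z theta T x) `]x - T, x[%classic (fun y => K0bar par (z - y))) /\
  (forall z, z < x - T ->
     s *: Emx Z (tau Z x T) (fun w => expR (- s * fine (tau Z x T w)))
            ([set w | xi_tau Z x T w < z] `&` A_minus Z x T) =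
     mxint (dH Z theta T x) `]x - T, x[%classic (fun y => K0 par (z - y))).
Proof.
have I0 : (`]x - T, x[%classic : set R) 0.
  by rewrite /= in_itv/= x_gt0 subr_lt0 x_ltT.
split=> z zx.
  apply: (exit_matrix_identity I0 s_gt0 theta_exp
    (J := `]z, +oo[%classic : set (measurableTypeR R))) => //.
  - by move=> y /=; rewrite !in_itv/= andbT => zy /andP[_ /(lt_trans zy)/(lt_trans zx)]; rewrite ltxx.
  (* Because z > x, a landing above z is automatically an exit through the upper end. *)
  - apply/seteqP; split=> w /=; rewrite in_itv/= andbT; first by move=> [[zw _] tw].
    by move=> [tw zw]; split=> //; split=> //; split=> //; rewrite ltW// (lt_trans zx).
  - move=> y /=; rewrite in_itv/= => /andP[_ yx].
    (* Here z - y > 0, as y < x < z, so the closed half-line may be replaced by the open one. In the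
       second identity [K0] is already the mass of an open half-line. *)
    rewrite K0bar_open; last by rewrite subr_gt0 (lt_trans yx).
    by congr (dK0 par _); apply/seteqP; split=> q /=; rewrite !in_itv/= !andbT ltrBlDl.
apply: (exit_matrix_identity I0 s_gt0 theta_exp
  (J := `]-oo, z[%classic : set (measurableTypeR R))) => //.
- by move=> y /=; rewrite !in_itv/= => yz /andP[/lt_trans/(_ yz)/lt_trans/(_ zx)]; rewrite ltxx.
- apply/seteqP; split=> w /=; rewrite in_itv/=; first by move=> [[zw _] tw].
  by move=> [tw zw]; split=> //; split=> //; split=> //; rewrite ltW// (lt_trans zw).
- move=> y _; rewrite /K0.
  by congr (dK0 par _); apply/seteqP; split=> q /=; rewrite !in_itv/= ltrBrDl.
Qed.
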